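(* Let $p$ be a prime, let $K/\mathbb Q_p$ be a finite extension with ring of integers $\mathcal O_K$ and maximal ideal $\mathfrak m_K$, and fix an algebraic closure $\overline K$ of $K$. Let $f\in\mathcal O_K[X]$ be monic of degree $d\geq 2$ with $f'(X)\in\mathfrak m_K\mathcal O_K[X]$. Let $t_0\in\mathcal O_K$ and let $(t_n)_{n\geq 0}$ be a sequence in $\overline K$ with $f(t_{n+1})=t_n$ for all $n\geq 0$. Put $K_n:=K(t_n)$ and $K_\infty:=\bigcup_{n\geq 0}K_n$. If $K_\infty/K$ is not unramified, then the valuations $v_K(\mathfrak D_{K_N/K})$, $N\geq 0$, of the differents are unbounded.
   Context: The valuation $v_K$ on $\overline K$ extends the valuation of $K$ normalized by $v_K(\pi_K)=1$ for a uniformizer $\pi_K$ of $K$. For a finite extension $F/K$, $\mathfrak D_{F/K}\subset\mathcal O_F$ denotes the different, and $v_K(\mathfrak D_{F/K})$ is the $v_K$-valuation of any generator of this ideal. An algebraic extension of $K$ is unramified if every finite subextension is unramified. *)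

(* Defs.v *)
From HB Require Import structures.
From mathcomp Require Import all_boot all_order all_algebra all_field.
From mathcomp Require Import boolp classical_sets constructive_ereal.

Set Implicit Arguments.
Unset Strict Implicit.
Unset Printing Implicit Defensive.

Import Order.TTheory GRing.Theory Num.Theory.
Local Open Scope classical_set_scope.
Local Open Scope ring_scope.

(** * Valuations *)

(* Rank-one valuations have values in rat, with +oo as the valuation of 0. *)
Definition is_valuation (F : fieldType) (v : F -> \bar rat) : Prop :=
  [/\ v 0 = +oo%E,
      forall x, x != 0 -> v x \is a fin_num,
      forall x y, v (x * y) = (v x + v y)%E
    & forall x y, (Order.min (v x) (v y) <= v (x + y)%R)%E].

Definition ring_of_integers (F : fieldType) (v : F -> \bar rat) : set F :=
  [set x | (0 <= v x)%E].

Definition maximal_ideal (F : fieldType) (v : F -> \bar rat) : set F :=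
  [set x | (0 < v x)%E].

Definition generates (F : fieldType) (v : F -> \bar rat) (I : set F) (a : F) :
    Prop :=
  I = [set a * y | y in ring_of_integers v].

Definition coefs_in (F : fieldType) (S : set F) (f : {poly F}) : Prop :=
  forall i, S f`_i.

(** * The field of p-adic numbers *)

Definition padic_val (p : nat) (x : rat) : \bar rat :=
  if x == 0 then +oo%E
  else ((logn p `|numq x|%N)%:R - (logn p `|denq x|%N)%:R)%:E.

Definition val_dense_rat (F : fieldType) (v : F -> \bar rat) : Prop :=
  forall (x : F) (B : rat), exists q : rat, (B%:E < v (x - ratr q)%R)%E.

Definition val_cauchy (F : fieldType) (v : F -> \bar rat) (u : nat -> F) :
    Prop :=
  forall B : rat, exists N : nat, forall i j : nat,
    (N <= i)%N -> (N <= j)%N -> (B%:E < v (u i - u j)%R)%E.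

Definition val_converges (F : fieldType) (v : F -> \bar rat) (u : nat -> F)
    (l : F) : Prop :=
  forall B : rat, exists N : nat, forall i : nat,
    (N <= i)%N -> (B%:E < v (u i - l)%R)%E.

(* (Qp, vp) is the completion of the rationals for the p-adic valuation; this
   determines the valued field up to a unique isomorphism. *)
Definition is_padic_field (p : nat) (Qp : fieldType) (vp : Qp -> \bar rat) :
    Prop :=
  [/\ is_valuation vp,
      forall x : rat, vp (ratr x) = padic_val p x,
      val_dense_rat vp
    & forall u, val_cauchy vp u -> exists l, val_converges vp u l].

(** * Finite and algebraic extensions of K inside an algebraic closure *)

Definition is_algebraic_closure (K : fieldType) (Kbar : closedFieldType)
    (iota : {rmorphism K -> Kbar}) : Prop :=
  forall x : Kbar, algebraicOver iota x.

(* vK extends the p-adic valuation up to scaling, and is normalized by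
   vK pi = 1 for a uniformizer pi of K. *)
Definition is_normalized_valuation (Qp : fieldType) (vp : Qp -> \bar rat)
    (K : fieldExtType Qp) (Kbar : closedFieldType)
    (iota : {rmorphism K -> Kbar}) (vK : Kbar -> \bar rat) : Prop :=
  [/\ is_valuation vK,
      exists2 e : rat, 0 < e & forall a : Qp, vK (iota a%:A) = (e%:E * vp a)%E
    & exists2 pi : K, generates (vK \o iota) (maximal_ideal (vK \o iota)) pi
                    & vK (iota pi) = 1%:E].

Section Extensions.
Variables (K : fieldType) (Kbar : closedFieldType).
Variables (iota : {rmorphism K -> Kbar}) (vK : Kbar -> \bar rat).

(* The subextensions of Kbar / K that are finite over K are the ranges of the
   K-embeddings into Kbar of the finite extensions of K. *)
Record finite_subext : Type := FiniteSubext {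
  subext_field :> fieldExtType K;
  subext_emb : {rmorphism subext_field -> Kbar};
  subext_embE : forall a : K, subext_emb a%:A = iota a }.

Definition subext_set (F : finite_subext) : set Kbar := range (subext_emb F).

Definition subext_val (F : finite_subext) : F -> \bar rat :=
  vK \o subext_emb F.

Definition field_trace (F : fieldExtType K) (x : F) : K :=
  \tr (passmx.mxof (vbasis {:F}) (vbasis {:F}) (amull x)).

Definition codifferent (F : finite_subext) : set F :=
  [set x | forall y : F, ring_of_integers (@subext_val F) y ->
             ring_of_integers (vK \o iota) (field_trace (x * y))].

Definition different (F : finite_subext) : set F :=
  [set x | forall y : F, @codifferent F y ->
             ring_of_integers (@subext_val F) (x * y)].

(* r is the valuation of the different of E / K, for a finite subextension E,
   i.e. the valuation of a generator of this ideal. *)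
Definition is_val_different (E : set Kbar) (r : rat) : Prop :=
  exists F : finite_subext, subext_set F = E /\
    exists2 delta : F, generates (@subext_val F) (@different F) delta
                     & subext_val delta = r%:E.

(* The ramification index is 1: F and K have the same value group. The residue
   fields are finite, so that the residue extension is always separable. *)
Definition unramified_finite (F : finite_subext) : Prop :=
  forall x : F, x != 0 ->
    exists2 a : K, a != 0 & subext_val x = vK (iota a).

Definition unramified (E : set Kbar) : Prop :=
  forall F : finite_subext, subext_set F `<=` E -> unramified_finite F.

Definition adjoin (t : Kbar) : set Kbar :=
  smallest [set S : set Kbar | GRing.divring_closed (mem S)]
           (range iota `|` [set t]).

End Extensions.

(* Main.v *)
(* Put K_n = K(t_n), let E_n be the valuation of the different of K_n / K, and suppose
   that E_n stays bounded; E_n is nondecreasing, so E_N - E_n -> 0. Then some z in K_N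
   has relative trace 1 over K_n and v(z) >= -(E_N - E_n). Because f is, modulo the
   maximal ideal, the p-th power of a polynomial, every u in O_K[t_n] is a P-th power
   b^P up to valuation 1, with b in O_K[t_N] and P = p^(N-n). As raising to the P-th
   power is additive modulo p, u = u (Tr z)^P = Tr(z b)^P up to an error of valuation
   at least 1 - P (E_N - E_n), so that u is almost a P-th power in K_n.
   Let mu be a lift to O_K[X] of the minimal polynomial of the residue class of t_n,
   of degree m. If K_n0 / K is ramified, then t_n0 stays away from all unramified
   extensions of K, and the resultant of mu with the minimal polynomial of t_n gives
   [K_n : K] v(mu(t_n)) <= m A with A independent of n. Since elements of K_n have
   valuations with denominator at most [K_n : K] / m, for P > A the element
   u = mu(t_n) can only be almost a P-th power if v(mu(t_n)) >= 1. Hence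
   v(t_n - c) >= 1 for a root c of mu. Each application of f increases this valuation
   by at least 1, so t_n0 is arbitrarily close to the unramified element f^(n-n0)(c),
   a contradiction. *)

From HB Require Import structures.
Require Import Defs.
From mathcomp Require Import all_boot all_order all_algebra all_field.
From mathcomp Require Import boolp classical_sets constructive_ereal.
From mathcomp Require Import zify ring lra.

Set Implicit Arguments.
Unset Strict Implicit.
Unset Printing Implicit Defensive.

Import Order.TTheory GRing.Theory Num.Theory.
Local Open Scope classical_set_scope.
Local Open Scope ring_scope.

(** * Valuations *)

(** The order of the choices is essential. The bound A depends only on n0; it fixes P = p^a with a >
    A and the tolerance eps = 1/(2a); only then is n taken so large that E_(n+a) - E_n < eps / P, so
    that the descent from level n + a to level n costs less than eps. A bound A growing with n would
    make this circular. The extensions K_N / K are in general not Galois, and v is merely some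
    extension of the valuation to the algebraic closure. An element of K(t) is therefore written
    h(t) with h in K[X], its conjugates are the h(r) for the roots r of the minimal polynomial, and
    v(h(r)) = v(h(t)) is deduced from completeness by an equivalence of norms. Of a root c of mu,
    the only trace of being unramified that is used is that all elements of K(c) have integral
    valuation, whereas ramification of K_n0 provides some h0(t_n0) with nonintegral valuation. *)

Section Valuation.
Variables (F : fieldType) (v : F -> \bar rat).
Hypothesis v_val : is_valuation v.

Definition valq (x : F) : rat := fine (v x).
Definition vge (q : rat) (x : F) : bool := (q%:E <= v x)%E.
Definition vgt (q : rat) (x : F) : bool := (q%:E < v x)%E.

Lemma eq_vge q x y : v x = v y -> vge q x = vge q y.
Proof. by rewrite /vge => ->. Qed.

Lemma eq_valq x y : v x = v y -> valq x = valq y.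
Proof. by rewrite /valq => ->. Qed.

Lemma v0 : v 0 = +oo%E. Proof. by case: v_val. Qed.

Lemma v_fin x : x != 0 -> v x = (valq x)%:E.
Proof. by case: v_val => _ H _ _ /H /fineK. Qed.

Lemma vgeE q x : vge q x = (x == 0) || (q <= valq x).
Proof.
rewrite /vge; have [->|x0] := eqVneq x 0; first by rewrite v0 leey.
by rewrite v_fin.
Qed.

Lemma vgtE q x : vgt q x = (x == 0) || (q < valq x).
Proof.
rewrite /vgt; have [->|x0] := eqVneq x 0; first by rewrite v0 ltry.
by rewrite v_fin.
Qed.

Lemma vge0 q : vge q 0. Proof. by rewrite vgeE eqxx. Qed.
Lemma vgt0 q : vgt q 0. Proof. by rewrite vgtE eqxx. Qed.

Lemma vgtW q x : vgt q x -> vge q x. Proof. exact: ltW. Qed.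

Lemma vge_le q r x : q <= r -> vge r x -> vge q x.
Proof. by move=> qr; apply: le_trans; rewrite lee_fin. Qed.

Lemma vge_vgt q r x : q < r -> vge r x -> vgt q x.
Proof. by move=> qr; apply: lt_le_trans; rewrite lte_fin. Qed.

Lemma valM x y : x != 0 -> y != 0 -> valq (x * y) = valq x + valq y.
Proof.
move=> x0 y0; case: v_val => _ _ H _.
have xy0 : x * y != 0 by rewrite mulf_neq0.
by apply/EFin_inj; rewrite EFinD -!v_fin // H.
Qed.

Lemma val1 : valq 1 = 0.
Proof. by have := valM (oner_neq0 F) (oner_neq0 F); rewrite mulr1; lra. Qed.

Lemma valX x n : x != 0 -> valq (x ^+ n) = n%:R * valq x.
Proof.
move=> x0; elim: n => [|n IH]; first by rewrite expr0 val1 mul0r.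
by rewrite exprS valM ?expf_neq0 // IH -natr1; lra.
Qed.

Lemma valV x : x != 0 -> valq x^-1 = - valq x.
Proof.
move=> x0; have := valM x0 (invr_neq0 x0).
by rewrite mulfV // val1; lra.
Qed.

Lemma val_div x y : x != 0 -> y != 0 -> valq (x / y) = valq x - valq y.
Proof. by move=> x0 y0; rewrite valM ?invr_neq0 // valV. Qed.

Lemma valN1 : valq (-1) = 0.
Proof.
have H : -1 != 0 :> F by rewrite oppr_eq0 oner_neq0.
by have := valM H H; rewrite mulrNN mulr1 val1; lra.
Qed.

Lemma valN x : x != 0 -> valq (- x) = valq x.
Proof.
by move=> x0; rewrite -mulN1r valM ?oppr_eq0 ?oner_neq0 // valN1 add0r.
Qed.

Lemma val_prod (I : eqType) (s : seq I) (G : I -> F) :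
  (forall i, i \in s -> G i != 0) ->
  valq (\prod_(i <- s) G i) = \sum_(i <- s) valq (G i).
Proof.
elim: s => [|i s IH] H; first by rewrite !big_nil val1.
rewrite !big_cons valM ?IH ?H ?mem_head //.
- by move=> j js; apply: H; rewrite in_cons js orbT.
- by rewrite prodf_seq_neq0; apply/allP => j js /=; rewrite H // in_cons js orbT.
Qed.

Lemma vgeD q x y : vge q x -> vge q y -> vge q (x + y).
Proof.
case: v_val => _ _ _ H hx hy.
by apply: le_trans (H x y); rewrite le_min; apply/andP.
Qed.

Lemma vgtD q x y : vgt q x -> vgt q y -> vgt q (x + y).
Proof.
case: v_val => _ _ _ H hx hy.
by apply: lt_le_trans (H x y); rewrite lt_min; apply/andP.
Qed.

Lemma vgeN q x : vge q (- x) = vge q x.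
Proof.
by rewrite !vgeE oppr_eq0; case: eqVneq => //= x0; rewrite valN.
Qed.

Lemma vgtN q x : vgt q (- x) = vgt q x.
Proof.
by rewrite !vgtE oppr_eq0; case: eqVneq => //= x0; rewrite valN.
Qed.

Lemma vgeB q x y : vge q x -> vge q y -> vge q (x - y).
Proof. by move=> hx hy; apply: vgeD; rewrite ?vgeN. Qed.

Lemma vgtB q x y : vgt q x -> vgt q y -> vgt q (x - y).
Proof. by move=> hx hy; apply: vgtD; rewrite ?vgtN. Qed.

Lemma vgeBC q x y : vge q (x - y) = vge q (y - x).
Proof. by rewrite -vgeN opprB. Qed.

Lemma vge_trans q y x z : vge q (x - y) -> vge q (y - z) -> vge q (x - z).
Proof. by move=> h1 h2; rewrite -(subrK y x) -addrA; apply: vgeD. Qed.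

Lemma vge_sum (I : Type) (s : seq I) (P : pred I) (G : I -> F) q :
  (forall i, P i -> vge q (G i)) -> vge q (\sum_(i <- s | P i) G i).
Proof. by move=> H; elim/big_rec: _ => [|i x /H]; [exact: vge0|exact: vgeD]. Qed.

Lemma vge_sum_seq (I : eqType) (s : seq I) (P : pred I) (G : I -> F) q :
  (forall i, i \in s -> P i -> vge q (G i)) -> vge q (\sum_(i <- s | P i) G i).
Proof.
move=> H; rewrite big_seq_cond; apply: vge_sum => i /andP [].
exact: H.
Qed.

Lemma vgt_sum (I : Type) (s : seq I) (P : pred I) (G : I -> F) q :
  (forall i, P i -> vgt q (G i)) -> vgt q (\sum_(i <- s | P i) G i).
Proof. by move=> H; elim/big_rec: _ => [|i x /H]; [exact: vgt0|exact: vgtD]. Qed.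

Lemma vgeM q r x y : vge q x -> vge r y -> vge (q + r) (x * y).
Proof.
rewrite !vgeE mulf_eq0; case: eqVneq => //= x0; case: eqVneq => //= y0.
by move=> hx hy; rewrite valM // lerD.
Qed.

Lemma vgeMl q x y : vge 0 x -> vge q y -> vge q (x * y).
Proof. by move=> hx hy; rewrite -[q]add0r vgeM. Qed.

Lemma vgeMr q x y : vge q x -> vge 0 y -> vge q (x * y).
Proof. by move=> hx hy; rewrite -[q]addr0 vgeM. Qed.

Lemma vgtMl q x y : vge 0 x -> vgt q y -> vgt q (x * y).
Proof.
rewrite vgeE !vgtE mulf_eq0; case: eqVneq => //= x0; case: eqVneq => //= y0.
by move=> hx hy; rewrite valM // ltr_wpDl.
Qed.

Lemma vge_nat q x (n : nat) : vge q x -> vge q (x *+ n).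
Proof. by move=> hx; elim: n => [|n IH]; rewrite ?vge0 // mulrS vgeD. Qed.

Lemma vge1 : vge 0 1. Proof. by rewrite vgeE val1 lexx orbT. Qed.

Lemma vge_natr n : vge 0 (n%:R : F).
Proof. exact/vge_nat/vge1. Qed.

Lemma vgt1F : vgt 0 1 = false. Proof. by rewrite vgtE val1 ltxx oner_eq0. Qed.

Lemma vgeX q x n : vge q x -> vge (n%:R * q) (x ^+ n).
Proof.
move=> hx; elim: n => [|n IH]; first by rewrite mul0r vge1.
by rewrite exprS -natr1 mulrDl mul1r addrC vgeM.
Qed.

Lemma vgeX0 x n : vge 0 x -> vge 0 (x ^+ n).
Proof. by move=> /(vgeX n); rewrite mulr0. Qed.

Lemma vge_inf x : (forall q, vge q x) -> x = 0.
Proof.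
move=> H; have := H (valq x + 1); rewrite vgeE => /orP [/eqP //|h].
by exfalso; lra.
Qed.

Lemma vge_val x : vge (valq x) x.
Proof. by rewrite vgeE lexx orbT. Qed.

Lemma val_addl x y : y != 0 -> vgt (valq y) x -> x + y != 0 /\ valq (x + y) = valq y.
Proof.
move=> y0 hx.
have xy0 : x + y != 0.
  apply/eqP => /eqP; rewrite addr_eq0 => /eqP e.
  by move: hx; rewrite e vgtN vgtE (negPf y0) ltxx.
split=> //; apply/eqP; rewrite eq_le; apply/andP; split.
- rewrite leNgt; apply/negP => h.
  have : vgt (valq y) (x + y - x) by apply: vgtB => //; rewrite vgtE h orbT.
  by rewrite addrC addKr vgtE (negPf y0) ltxx.
- have : vge (valq y) (x + y) by apply: vgeD; [exact: vgtW|exact: vge_val].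
  by rewrite vgeE (negPf xy0).
Qed.

Lemma vgt0_unit x : vge 0 x -> ~~ vgt 0 x -> x != 0 /\ valq x = 0.
Proof.
rewrite vgeE vgtE negb_or -leNgt => h /andP [x0 h2]; split=> //.
by move: h; rewrite (negPf x0) /= => h; apply/eqP; rewrite eq_le h h2.
Qed.

Lemma vgtM0 x y : vge 0 x -> vge 0 y -> vgt 0 (x * y) -> vgt 0 x \/ vgt 0 y.
Proof.
move=> hx hy h; apply/orP; apply: contraT; rewrite negb_or => /andP [h1 h2].
have [x0 ex] := vgt0_unit hx h1; have [y0 ey] := vgt0_unit hy h2.
by move: h; rewrite vgtE mulf_eq0 (negPf x0) (negPf y0) valM // ex ey addr0 ltxx.
Qed.

Lemma vgtX0 x n : vge 0 x -> vgt 0 (x ^+ n) -> vgt 0 x.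
Proof.
move=> hx; elim: n => [|n IH]; first by rewrite vgt1F.
by rewrite exprS => /(vgtM0 hx (vgeX0 n hx)) [//|/IH].
Qed.

(** A nonzero term of least valuation would dominate the sum of the others. This yields independence
    over K of elements whose valuations differ modulo the integers. *)
Lemma sum_distinct_val (n : nat) (x : 'I_n -> F) :
  (forall i j, i != j -> x i != 0 -> x j != 0 -> valq (x i) != valq (x j)) ->
  \sum_i x i = 0 -> forall i, x i = 0.
Proof.
move=> H S i; apply/eqP; apply: contraT => xi0.
have [k xk0 kmin] := @arg_minP _ _ _ i (fun i => x i != 0) (fun i => valq (x i)) xi0.
have : vgt (valq (x k)) (- \sum_(l | l != k) x l).
  rewrite vgtN; apply: vgt_sum => l lk; rewrite vgtE; case: eqVneq => //= xl0.
  by rewrite lt_neqAle kmin // andbT H // eq_sym.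
have -> : - (\sum_(l | l != k) x l) = x k.
  by move: S; rewrite (bigD1 k) //= => /eqP; rewrite addr_eq0 => /eqP ->.
by rewrite vgtE (negPf xk0) ltxx.
Qed.

(** The other factor of x^n - y^n is homogeneous of degree n - 1, so the gain 1 survives. Negative
    [a] matters: the elements compared later have poles bounded by the different. *)
Lemma vge_subX a n x y : vge a x -> vge a y -> vge (1 + a) (x - y) ->
  vge (1 + n%:R * a) (x ^+ n - y ^+ n).
Proof.
move=> hx hy hxy; case: n => [|n]; first by rewrite subrr vge0.
have -> : 1 + n.+1%:R * a = (1 + a) + n%:R * a by rewrite -natr1; ring.
rewrite subrXX; apply: vgeM => //; apply: vge_sum => i _.
have -> : n%:R * a = (n.+1.-1 - i)%:R * a + (i : nat)%:R * a.
  by rewrite -mulrDl -natrD subnK // -ltnS.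
by apply: vgeM; apply: vgeX.
Qed.

Lemma vge_subX0 n x y : vge 0 x -> vge 0 y -> vge 1 (x - y) ->
  vge 1 (x ^+ n - y ^+ n).
Proof.
by move=> hx hy h; have := @vge_subX 0 n x y hx hy; rewrite mulr0 !addr0; exact.
Qed.

(** * Additivity of the Frobenius map modulo p *)

Section Frobenius.
Variable p : nat.
Hypotheses (p_prime : prime p) (v_p : vge 1 (p%:R : F)).

(** The middle binomial coefficients are divisible by p, of valuation at least 1, and every monomial
    has degree p. *)
Lemma freshman2 a x y : vge a x -> vge a y ->
  vge (1 + p%:R * a) ((x + y) ^+ p - (x ^+ p + y ^+ p)).
Proof.
move=> hx hy; have p0 := prime_gt0 p_prime.
have -> : (x + y) ^+ p - (x ^+ p + y ^+ p) =
    \sum_(1 <= i < p) x ^+ (p - i) * y ^+ i *+ 'C(p, i).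
  rewrite exprDn -(big_mkord xpredT (fun i => x ^+ (p - i) * y ^+ i *+ 'C(p, i))).
  rewrite big_nat_recr //= big_ltn // subnn subn0 expr0 mul1r binn bin0 !mulr1n.
  by ring.
rewrite big_nat; apply: vge_sum => i /andP [i0 ip].
have /dvdnP [c ->] : (p %| 'C(p, i))%N by apply: prime_dvd_bin; rewrite ?i0.
rewrite mulnC mulrnA; apply: vge_nat; rewrite -[X in vge _ X]mulr_natl; apply: vgeM => //.
have -> : p%:R * a = (p - i)%:R * a + i%:R * a.
  by rewrite -mulrDl -natrD subnK // ltnW.
by apply: vgeM; apply: vgeX.
Qed.

Lemma freshman1 (I : eqType) (s : seq I) (G : I -> F) a :
  (forall i, i \in s -> vge a (G i)) ->
  vge (1 + p%:R * a) ((\sum_(i <- s) G i) ^+ p - \sum_(i <- s) G i ^+ p).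
Proof.
elim: s => [|i s IH] H.
  by rewrite !big_nil expr0n gtn_eqF ?prime_gt0 // subrr vge0.
have Hs j : j \in s -> vge a (G j) by move=> js; apply: H; rewrite in_cons js orbT.
rewrite !big_cons; set S := \sum_(j <- s) G j; set T := \sum_(j <- s) _ ^+ _.
apply: (@vge_trans _ (G i ^+ p + S ^+ p)).
  by apply: freshman2; [exact: H (mem_head _ _)|by apply: vge_sum_seq => j /Hs].
by rewrite opprD addrACA subrr add0r; exact: IH.
Qed.

Lemma freshman (I : eqType) (s : seq I) (G : I -> F) a k :
  (forall i, i \in s -> vge a (G i)) ->
  vge (1 + (p ^ k)%:R * a)
    ((\sum_(i <- s) G i) ^+ (p ^ k) - \sum_(i <- s) G i ^+ (p ^ k)).
Proof.
move=> H; elim: k => [|k IH].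
  by under [X in _ - X]eq_bigr do rewrite expr1; rewrite expr1 subrr vge0.
have e : (p ^ k.+1)%:R * a = p%:R * ((p ^ k)%:R * a).
  by rewrite expnS natrM; ring.
(* The errors do not accumulate: [vge_subX] raises the congruence for k to the p-th power with the
   same gain 1, and [freshman1] expands the p-th power of the remaining sum. *)
rewrite e; apply: (@vge_trans _ ((\sum_(i <- s) G i ^+ (p ^ k)) ^+ p)).
  rewrite expnSr exprM; apply: vge_subX => //.
    by apply: vgeX; apply: vge_sum_seq => i /H.
  by apply: vge_sum_seq => i /H h _; apply: vgeX.
have -> : \sum_(i <- s) G i ^+ (p ^ k.+1) = \sum_(i <- s) (G i ^+ (p ^ k)) ^+ p.
  by apply: eq_bigr => i _; rewrite expnSr exprM.
by apply: freshman1 => i /H; apply: vgeX.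
Qed.

End Frobenius.

End Valuation.

(** * Finite-dimensional spaces over a complete field *)

Lemma rat_bound (x : rat) : exists n : nat, x < n%:R.
Proof.
by exists (Num.bound `|x|); apply: le_lt_trans (archi_boundP _); rewrite ?ler_norm.
Qed.

Section Complete.
Variables (F0 F : fieldType) (v : F -> \bar rat) (j : {rmorphism F0 -> F}).
Hypothesis v_val : is_valuation v.
Hypothesis j_complete :
  forall u, val_cauchy (v \o j) u -> exists l, val_converges (v \o j) u l.

(* If the last vector were at distance 0 from the span of the others, it would
   belong to it by completeness. *)
Lemma norm_equiv n (w : nat -> F) :
  (forall a : nat -> F0, \sum_(i < n) j (a i) * w i = 0 ->
     forall i, (i < n)%N -> a i = 0) ->
  exists C : rat, forall (a : nat -> F0) q,
    vge v q (\sum_(i < n) j (a i) * w i) ->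
    forall i, (i < n)%N -> vge v (q - C) (j (a i)).
Proof.
elim: n => [|n IH] ind; first by exists 0.
have [C HC] : exists C : rat, forall (a : nat -> F0) q,
    vge v q (\sum_(i < n) j (a i) * w i) ->
    forall i, (i < n)%N -> vge v (q - C) (j (a i)).
  apply: IH => a S i ilt; have := ind (fun i => if (i < n)%N then a i else 0).
  rewrite big_ord_recr /= ltnn rmorph0 mul0r addr0.
  under eq_bigr do rewrite ltn_ord.
  by move=> /(_ S i (ltnW ilt)); rewrite ilt.
have [C1 HC1] : exists C1 : rat, forall a : nat -> F0,
    ~ vge v C1 (w n + \sum_(i < n) j (a i) * w i).
  (* Otherwise the span of the first n vectors comes arbitrarily near to [- w n]. Differences of two
     approximations lie in that span, so by [HC] their coordinates are Cauchy, and the limits give a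
     relation in which [w n] has coefficient 1. *)
  apply: contrapT => nC.
  have /choice [a Ha] : forall k : nat, exists a : nat -> F0,
      vge v k%:R (w n + \sum_(i < n) j (a i) * w i).
    by move=> k; apply: contrapT => na; apply: nC; exists k%:R => a Ha; apply: na; exists a.
  have /choice [l Hl] : forall i, exists l : F0,
      (i < n)%N -> val_converges (v \o j) (fun k => a k i) l.
    move=> i; case: (ltnP i n) => [ilt|_]; last by exists 0.
    suff : val_cauchy (v \o j) (fun k => a k i) by move=> /j_complete [l Hl]; exists l.
    move=> B; have [N HN] := rat_bound (B + C); exists N => k1 k2 h1 h2 /=.
    suff /(HC (fun i => a k1 i - a k2 i))/(_ i ilt) :
        vge v N%:R (\sum_(i < n) j (a k1 i - a k2 i) * w i).
      by apply: vge_vgt; lra.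
    have -> : \sum_(i < n) j (a k1 i - a k2 i) * w i =
        (w n + \sum_(i < n) j (a k1 i) * w i) -
        (w n + \sum_(i < n) j (a k2 i) * w i).
      rewrite opprD addrACA subrr add0r -sumrB.
      by apply: eq_bigr => k _; rewrite rmorphB mulrBl.
    by apply: vgeB => //; apply: vge_le (Ha _); rewrite ler_nat.
  have S0 : w n + \sum_(i < n) j (l i) * w i = 0.
    apply: (vge_inf v_val) => q.
    have [N HN] : exists N : nat, forall (i : 'I_n) k, (N <= k)%N ->
        vge v q (j (a k i - l i) * w i).
      have /choice [N HN] : forall i : 'I_n, exists N : nat, forall k, (N <= k)%N ->
          vge v q (j (a k i - l i) * w i).
        move=> i; have [N HN] := Hl i (ltn_ord i) (q - valq v (w i)).
        exists N => k /HN /ltW hk.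
        by rewrite -[q](subrK (valq v (w i))); apply: vgeM (vge_val _ _).
      exists (\max_(i < n) N i) => i k hk; apply: HN.
      by apply: leq_trans hk; apply: leq_bigmax.
    have [k0 hk0] := rat_bound q; set k := maxn N k0.
    have -> : w n + \sum_(i < n) j (l i) * w i =
        (w n + \sum_(i < n) j (a k i) * w i) - \sum_(i < n) j (a k i - l i) * w i.
      rewrite -addrA -sumrB; congr (_ + _); apply: eq_bigr => i _.
      by rewrite rmorphB -mulrBl; congr (_ * _); ring.
    apply: vgeB => //.
      apply: vge_le (Ha k); apply: le_trans (ltW hk0) _.
      by rewrite ler_nat leq_maxr.
    by apply: vge_sum => // i _; apply: HN; rewrite leq_maxl.
  have := ind (fun i => if (i < n)%N then l i else 1).
  rewrite big_ord_recr /= ltnn rmorph1 mul1r.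
  under eq_bigr do rewrite ltn_ord.
  by rewrite addrC => /(_ S0 n (ltnSn n)); rewrite ltnn => /eqP; rewrite oner_eq0.
have step (a : nat -> F0) q : vge v q (\sum_(i < n.+1) j (a i) * w i) ->
    vge v (q - C1) (j (a n)).
  have [->|an0] := eqVneq (a n) 0; first by rewrite rmorph0 vge0.
  have jan0 : j (a n) != 0 by rewrite fmorph_eq0.
  have /negP := HC1 (fun i => a i / a n).
  have -> : w n + \sum_(i < n) j (a i / a n) * w i =
      (\sum_(i < n.+1) j (a i) * w i) / j (a n).
    rewrite big_ord_recr /= mulrDl addrC; congr (_ + _); last by rewrite mulrAC mulfV // mul1r.
    by rewrite mulr_suml; apply: eq_bigr => i _; rewrite fmorph_div mulrAC.
  set S := \sum_(i < n.+1) _; rewrite !vgeE //.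
  rewrite mulf_eq0 invr_eq0 (negPf jan0) orbF; case: eqVneq => //= S0.
  by rewrite val_div // => h1 h2; lra.
(* Removing the last term lowers the bound by at most [- m], since [step] controls its coefficient
   up to [C1]. *)
pose m := Num.min 0 (valq v (w n) - C1).
exists (Num.max C1 (C - m)) => a q h i; rewrite ltnS leq_eqVlt => /orP [/eqP ->|ilt].
  by apply: vge_le (step a q h) => //; rewrite lerD2l lerN2 le_max lexx.
have h2 : vge v (q + m) (\sum_(i < n) j (a i) * w i).
  have -> : \sum_(i < n) j (a i) * w i =
     \sum_(i < n.+1) j (a i) * w i - j (a n) * w n.
    by rewrite big_ord_recr /= addrK.
  apply: vgeB => //.
    by apply: vge_le h => //; rewrite gerDl ge_min lexx.
  apply: vge_le (vgeM v_val (step a q h) (vge_val v_val _)).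
  by rewrite -addrA lerD2l ge_min [- C1 + _]addrC lexx orbT.
apply: vge_le (HC a _ h2 i ilt).
by rewrite -addrA lerD2l lerNl opprD opprK addrC le_max lexx orbT.
Qed.
End Complete.

(** * Conjugates and traces *)

Section Conjugates.
Variables (K : fieldType) (Kbar : closedFieldType) (iota : {rmorphism K -> Kbar}).
Hypothesis Kbar_closure : is_algebraic_closure iota.
Hypothesis char0 : forall n, n.+1%:R != 0 :> K.

(** A polynomial over K stands for an element of K(x); evaluating it at another conjugate of x
    replaces the application of an embedding of K(x). *)
Definition ev (h : {poly K}) (x : Kbar) : Kbar := (map_poly iota h).[x].

Lemma ev_horner h x : ev h x = (map_poly iota h).[x].
Proof. by []. Qed.
Lemma evD h g x : ev (h + g) x = ev h x + ev g x.
Proof. by rewrite /ev rmorphD hornerD. Qed.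
Lemma evB h g x : ev (h - g) x = ev h x - ev g x.
Proof. by rewrite /ev rmorphB hornerD hornerN. Qed.
Lemma evM h g x : ev (h * g) x = ev h x * ev g x.
Proof. by rewrite /ev rmorphM hornerM. Qed.
Lemma evX h n x : ev (h ^+ n) x = ev h x ^+ n.
Proof. by rewrite /ev rmorphXn horner_exp. Qed.
Lemma ev1 x : ev 1 x = 1.
Proof. by rewrite /ev rmorph1 hornerE. Qed.
Lemma ev0 x : ev 0 x = 0.
Proof. by rewrite /ev rmorph0 hornerE. Qed.
Lemma evC a x : ev a%:P x = iota a.
Proof. by rewrite /ev map_polyC hornerC. Qed.
Lemma evZ a h x : ev (a *: h) x = iota a * ev h x.
Proof. by rewrite -mul_polyC evM evC. Qed.
Lemma ev_polyX x : ev 'X x = x.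
Proof. by rewrite /ev map_polyX hornerX. Qed.
Lemma ev_polyXn n x : ev 'X^n x = x ^+ n.
Proof. by rewrite evX ev_polyX. Qed.
Lemma ev_sum (I : Type) (s : seq I) (P : pred I) (G : I -> {poly K}) x :
  ev (\sum_(i <- s | P i) G i) x = \sum_(i <- s | P i) ev (G i) x.
Proof. by rewrite /ev rmorph_sum horner_sum. Qed.
Lemma ev_comp h g x : ev (h \Po g) x = ev h (ev g x).
Proof. by rewrite /ev map_comp_poly horner_comp. Qed.
Lemma ev_coef n (h : {poly K}) x : (size h <= n)%N -> ev h x = \sum_(i < n) iota h`_i * x ^+ i.
Proof.
move=> hn; rewrite /ev (@horner_coef_wide _ n) ?size_map_poly //.
by apply: eq_bigr => i _; rewrite coef_map.
Qed.
Definition evE := (evD, evB, evM, evX, ev1, ev0, evC, ev_polyX, ev_comp).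

(* M is the minimal polynomial over K of each of the elements of rs, its roots. *)
Definition conjugates (M : {poly K}) (rs : seq Kbar) : Prop :=
  [/\ M \is monic, map_poly iota M = \prod_(r <- rs) ('X - r%:P), uniq rs
    & forall h r, r \in rs -> ev h r = 0 -> M %| h].

Lemma deriv_neq0 (M : {poly K}) : (1 < size M)%N -> M^`() != 0.
Proof.
move=> sM; apply/eqP => /(congr1 (fun q : {poly K} => q`_(size M).-2)).
rewrite coef_deriv coef0 prednK; last by case: (size M) sM => [|[]].
move=> /eqP; rewrite -mulr_natr mulf_eq0 -lead_coefE lead_coef_eq0.
rewrite -size_poly_eq0; case: (size M) sM => [|[|n]] //= _.
by apply/negP; exact: char0.
Qed.

Lemma conjugates_ex t : exists M rs, conjugates M rs /\ t \in rs.
Proof.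
have [h h0 ht] := Kbar_closure t.
have exn : exists n, `[< exists M : {poly K}, [/\ M != 0, ev M t = 0 & size M = n] >].
  by exists (size h); apply/asboolP; exists h; split=> //; apply/rootP.
have [n /asboolP [M0 [M0n0 M0t sM0]] nmin] := ex_minnP exn.
have l0 : lead_coef M0 != 0 by rewrite lead_coef_eq0.
pose M := (lead_coef M0)^-1 *: M0.
have M0' : M != 0 by rewrite scaler_eq0 invr_eq0 negb_or l0.
have M_monic : M \is monic by rewrite monicE lead_coefZ mulVf.
have Mt : root (map_poly iota M) t.
  by apply/rootP; rewrite -/(ev M t) evZ M0t mulr0.
have irrM : irreducible_poly M.
  apply/(subfx_irreducibleP Mt M0') => q qt q0.
  rewrite size_scale ?invr_eq0 // sM0; apply: nmin; apply/asboolP.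
  by exists q; split=> //; apply/rootP.
have [rs Ers] := closed_field_poly_normal (map_poly iota M).
have {}Ers : map_poly iota M = \prod_(r <- rs) ('X - r%:P).
  by rewrite {1}Ers lead_coef_map (monicP M_monic) rmorph1 scale1r.
have M'0 : M^`() != 0 by apply: deriv_neq0; case: irrM.
exists M, rs; split; last by rewrite -root_prod_XsubC -Ers.
split=> // [|g r].
  rewrite -separable_prod_XsubC -Ers separable_map unlock.
  rewrite irreducible_poly_coprime //; apply/negP => /(dvdp_leq M'0).
  by rewrite leqNgt lt_size_deriv.
rewrite -root_prod_XsubC -Ers => /rootP; rewrite -/(ev M r) => Mr gr.
apply: contraT; rewrite -irreducible_poly_coprime //.
case/Bezout_eq1_coprimepP => -[a b] /= /(congr1 (ev^~ r)).
by rewrite /= !evE Mr gr !mulr0 addr0 => /eqP; rewrite eq_sym oner_eq0.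
Qed.

Section OneOrbit.
Variables (M : {poly K}) (rs : seq Kbar).
Hypothesis C : conjugates M rs.

Lemma conj_root r : (r \in rs) = (ev M r == 0).
Proof. by case: C => _ E _ _; rewrite /ev E -rootE root_prod_XsubC. Qed.

Lemma conj_ev0 h r r' : r \in rs -> r' \in rs -> ev h r = 0 -> ev h r' = 0.
Proof.
case: C => _ _ _ H hr hr' /(H _ _ hr) /dvdpP [q ->].
by rewrite evM; move: hr'; rewrite conj_root => /eqP ->; rewrite mulr0.
Qed.

Lemma conj_ev_eq h g r r' : r \in rs -> r' \in rs -> ev h r = ev g r ->
  ev h r' = ev g r'.
Proof.
move=> hr hr' e; apply/eqP; rewrite -subr_eq0 -evB; apply/eqP.
by apply: (conj_ev0 hr hr'); rewrite evB e subrr.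
Qed.

Lemma conj_size : size M = (size rs).+1.
Proof.
case: C => _ E _ _.
by rewrite -(size_map_poly iota) E size_prod_XsubC.
Qed.

Lemma conj_evM x : ev M x = \prod_(r <- rs) (x - r).
Proof.
case: C => _ E _ _; rewrite /ev E horner_prod.
by apply: eq_bigr => r _; rewrite hornerXsubC.
Qed.

Lemma conj_mod h r : r \in rs -> ev (h %% M) r = ev h r.
Proof.
move=> hr; rewrite {2}(divp_eq h M) !evE.
by move: hr; rewrite conj_root => /eqP ->; rewrite mulr0 add0r.
Qed.

Lemma conj_mod_size h : (size (h %% M)%R <= size rs)%N.
Proof.
rewrite -ltnS -conj_size ltn_modp -size_poly_gt0 conj_size //.
Qed.

Lemma conj_inv h r : r \in rs -> ev h r != 0 -> exists g, ev g r = (ev h r)^-1.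
Proof.
case: C => M_monic _ _ H hr hr0.
have /Bezout_eq1_coprimepP [[a b] /= E] : coprimep M h.
  rewrite -(coprimep_map iota); apply/Pdiv.ClosedField.coprimepP => x.
  move=> /rootP /eqP; rewrite -[_.[_]]/(ev M x) -conj_root => hx.
  by apply/eqP => /(conj_ev0 hx hr) /eqP; rewrite (negPf hr0).
exists b; apply: (mulIf hr0); rewrite mulVf //.
have := congr1 (ev^~ r) E; rewrite /= !evE.
by move: hr; rewrite conj_root => /eqP ->; rewrite mulr0 add0r.
Qed.

End OneOrbit.

(** Invertibility of the Vandermonde matrix: the relations are combined into one for the polynomial
    that vanishes at every point except r. *)
Lemma power_sums_inj (rs : seq Kbar) (c : Kbar -> Kbar) : uniq rs ->
  (forall i, (i < size rs)%N -> \sum_(r <- rs) c r * r ^+ i = 0) ->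
  forall r, r \in rs -> c r = 0.
Proof.
move=> u H r hr.
pose P := \prod_(s <- rem r rs) ('X - s%:P).
have sP : size P = size rs by rewrite size_prod_XsubC size_rem // prednK //; case: (rs) hr.
have S : \sum_(s <- rs) c s * P.[s] = 0.
  under eq_bigr do rewrite horner_coef mulr_sumr.
  rewrite exchange_big big1 //= => i _.
  under eq_bigr do rewrite mulrCA.
  by rewrite -mulr_sumr H ?mulr0 // -sP.
move: S; rewrite (big_rem r) //= big_seq big1 => [|s hs]; last first.
  by move: hs; rewrite -root_prod_XsubC -/P => /rootP ->; rewrite mulr0.
move/eqP; rewrite addr0 mulf_eq0 -rootE root_prod_XsubC mem_rem_uniq //.
by rewrite inE eqxx orbF => /eqP.
Qed.

Lemma sum_fibers (rs rs' : seq Kbar) (phi G : Kbar -> Kbar) : uniq rs' ->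
  (forall r, r \in rs -> phi r \in rs') ->
  \sum_(r <- rs) G r = \sum_(r' <- rs') \sum_(r <- rs | phi r == r') G r.
Proof.
move=> u H; rewrite (exchange_big_dep xpredT) //= big_seq [RHS]big_seq.
apply: eq_bigr => r hr; rewrite -big_filter.
rewrite (_ : [seq _ <- _ | _] = [:: phi r]) ?big_seq1 //.
by rewrite -(filter_pred1_uniq u (H _ hr)); apply: eq_filter => x /=; rewrite eq_sym.
Qed.

(* This is the trace K_N -> K_n when phi(t_N) = t_n; g is found by inverting the
   Gram matrix of the trace form of K_n / K. *)
Lemma relative_trace M rs M' rs' (phi : {poly K}) :
  conjugates M rs -> conjugates M' rs' ->
  (forall r, r \in rs -> ev phi r \in rs') ->
  (forall h, exists a, \sum_(r <- rs) ev h r = iota a) ->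
  (forall h, exists a, \sum_(r <- rs') ev h r = iota a) ->
  forall h, exists g, forall r', r' \in rs' ->
    ev g r' = \sum_(r <- rs | ev phi r == r') ev h r.
Proof.
move=> C C' Hphi /choice [T HT] /choice [T' HT'] h.
have [_ _ u' min'] := C'; have [_ _ u _] := C.
pose D := size rs'.
pose G := \matrix_(i < D, k < D) T' ('X^i * 'X^k).
have evrow (a : 'rV[K]_D) x : ev (rVpoly a) x = \sum_(i < D) iota (a 0 i) * x ^+ i.
  rewrite (ev_coef x (size_poly _ _)); apply: eq_bigr => i _.
  by rewrite coef_rVpoly_ord.
have mulG (a : 'rV[K]_D) k :
    iota ((a *m G) 0 k) = \sum_(r' <- rs') ev (rVpoly a) r' * r' ^+ k.
  rewrite mxE rmorph_sum /=; under [RHS]eq_bigr do rewrite evrow mulr_suml.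
  rewrite exchange_big /=; apply: eq_bigr => i _.
  rewrite rmorphM !mxE -HT' mulr_sumr; apply: eq_bigr => r' _.
  by rewrite evM !ev_polyXn mulrA.
(* A kernel vector is a polynomial of degree less than D whose products with the powers have zero
   trace; it vanishes on [rs'], hence is zero by minimality of [M']. *)
have G_unit : G \in unitmx.
  rewrite -row_free_unit; apply: inj_row_free => a aG.
  have /power_sums_inj H : forall i, (i < D)%N ->
      \sum_(r' <- rs') ev (rVpoly a) r' * r' ^+ i = 0.
    by move=> i iD; rewrite -(mulG a (Ordinal iD)) aG mxE rmorph0.
  have [D0|D0] := posnP D; first by apply/rowP => -[i hi]; exfalso; rewrite D0 in hi.
  have [r' hr'] : exists r', r' \in rs'.
    by move: D0; rewrite /D; case: (rs') => // x s _; exists x; rewrite mem_head.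
  have dv := min' _ _ hr' (H u' _ hr').
  have a0 : rVpoly a = 0.
    apply/eqP; apply: contraT => /dvdp_leq /(_ dv).
    by rewrite (conj_size C') ltnNge size_poly.
  by rewrite -(rVpolyK a) a0 linear0.
(* [g] is chosen so that Tr(g X^k) = Tr(h phi^k) for k < D. Both sides are power sums over [rs'],
   weighted by [g] and by the sums of [h] over the fibres, so the weights agree at each root. *)
pose l : 'rV[K]_D := \row_k T (h * phi ^+ k).
exists (rVpoly (l *m invmx G)) => r' hr'; apply/eqP; rewrite -subr_eq0; apply/eqP.
pose c r' := ev (rVpoly (l *m invmx G)) r' - \sum_(r <- rs | ev phi r == r') ev h r.
apply: (@power_sums_inj rs' c) => // k kD.
under eq_bigr do rewrite mulrBl; rewrite sumrB.
rewrite -(mulG _ (Ordinal kD)) mulmxKV // mxE -HT /=.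
apply/eqP; rewrite subr_eq0; apply/eqP.
rewrite (sum_fibers _ u' Hphi); apply: eq_bigr => s _.
by rewrite mulr_suml; apply: eq_bigr => r /eqP <-; rewrite evM evX.
Qed.

End Conjugates.

(** * Simple extensions and their matrix traces *)

Section SimpleExtensions.
Variables (K : fieldType) (Kbar : closedFieldType) (iota : {rmorphism K -> Kbar}).
Local Notation ev := (ev iota).
Variables (M : {poly K}) (rs : seq Kbar) (t : Kbar).
Hypotheses (C : conjugates iota M rs) (t_rs : t \in rs).

Lemma adjoinE : adjoin iota t = [set x | exists h, x = ev h t].
Proof.
apply/seteqP; split.
  apply: smallest_sub; last first.
    move=> x [[a _ <-]|->]; first by exists a%:P; rewrite evC.
    by exists 'X; rewrite ev_polyX.
  split; first by rewrite inE; exists 1; rewrite ev1.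
    move=> x y; rewrite !inE => -[h ->] [g ->].
    by exists (h - g); rewrite evB.
  move=> x y; rewrite !inE => -[h ->] [g ->].
  (* Closure under division includes x / 0, which equals 0. *)
  have [g0|g0] := eqVneq (ev g t) 0.
    by exists 0; rewrite ev0 g0 invr0 mulr0.
  by have [k k_inv] := conj_inv C t_rs g0; exists (h * k); rewrite evM k_inv.
move=> _ [h ->] S /= [[S1 SB SM] sub].
have S0 : 0 \in S by rewrite -(subrr 1); apply: SB.
have SN x : x \in S -> - x \in S by move=> hx; rewrite -sub0r; apply: SB.
have SD x y : x \in S -> y \in S -> x + y \in S.
  by move=> hx hy; rewrite -(opprK y); apply: SB => //; apply: SN.
have SV x : x \in S -> x^-1 \in S by move=> hx; rewrite -div1r; apply: SM.
have SMM x y : x \in S -> y \in S -> x * y \in S.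
  by move=> hx hy; rewrite -(invrK y); apply: SM => //; apply: SV.
rewrite -in_setE; elim/poly_ind: h => [|h a IH]; first by rewrite ev0.
rewrite !evE; apply: SD; first apply: SMM => //; rewrite in_setE; apply: sub.
  by right.
by left; exists a.
Qed.

Lemma simple_subext : exists F : finite_subext iota, subext_set F = adjoin iota t.
Proof.
case: (C) => M_monic _ _ H.
have Mt : root (map_poly iota M) t by apply/rootP; move: t_rs; rewrite (conj_root C) => /eqP.
have M0 := monic_neq0 M_monic.
have irrM : irreducible_poly M.
  apply/(subfx_irreducibleP Mt M0) => q /rootP qt q0.
  by apply: dvdp_leq => //; apply: H qt.
exists (@FiniteSubext _ _ iota (SubFieldExtType Mt irrM) (subfx_inj : {rmorphism _ -> _})
   (subfx_inj_base Mt M0)).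
rewrite adjoinE; apply/seteqP; split => x.
  by move=> [y _ <-] /=; have [q ->] := subfxE y; exists q; rewrite subfx_inj_eval.
by move=> [q ->]; exists (subfx_eval iota t M q) => //=; rewrite subfx_inj_eval.
Qed.

Section Trace.
Variable F : finite_subext iota.
Hypothesis F_t : subext_set F = adjoin iota t.
Local Notation emb := (subext_emb F).

Lemma emb_ex h : exists x : F, emb x = ev h t.
Proof.
have : subext_set F (ev h t) by rewrite F_t adjoinE; exists h.
by case=> x _ <-; exists x.
Qed.

Lemma emb_ev x : exists h, emb x = ev h t.
Proof.
have : subext_set F (emb x) by exists x.
by rewrite F_t adjoinE => -[h ->]; exists h.
Qed.

Lemma embZ a (x : F) : emb (a *: x) = iota a * emb x.
Proof. by rewrite -(subext_embE F) -rmorphM mulr_algl. Qed.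

(** Half of an equality; the other half comes from the rank of the matrix of conjugates in
    [field_traceE]. *)
Lemma subext_dim : (\dim {:F} <= size rs)%N.
Proof.
have [z ez] := emb_ex 'X; rewrite ev_polyX in ez.
pose s := mkseq (fun i => z ^+ i) (size rs).
apply: leq_trans (_ : (\dim <<s>> <= _)%N); last first.
  by rewrite (leq_trans (dim_span _)) // size_mkseq.
apply/dimvS/subvP => x _; have [h hx] := emb_ev x.
have -> : x = \sum_(i < size rs) (h %% M)`_i *: z ^+ i.
  apply: (fmorph_inj emb); rewrite hx -(conj_mod C _ t_rs).
  rewrite (ev_coef _ _ (conj_mod_size C h)) rmorph_sum; apply: eq_bigr => i _.
  by rewrite embZ rmorphXn ez.
apply: memv_suml => i _; apply/memvZ/memv_span.
by apply/mapP; exists (i : nat); rewrite // mem_iota add0n ltn_ord.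
Qed.

(* In the basis of embeddings of F into Kbar, multiplication by x is diagonal. *)
Lemma field_traceE (x : F) h : emb x = ev h t ->
  iota (field_trace x) = \sum_(r <- rs) ev h r.
Proof.
move=> hx; pose n := \dim {:F}; pose D := size rs.
pose b := vbasis {:F}.
have /choice [beta Hbeta] : forall i : 'I_n, exists g, emb b`_i = ev g t.
  by move=> i; exact: emb_ev.
pose X : 'M[K]_n := passmx.mxof b b (amull x).
have HX i r : r \in rs -> ev (h * beta i) r = \sum_k iota (X i k) * ev (beta k) r.
  move=> hr; have -> : \sum_k iota (X i k) * ev (beta k) r =
      ev (\sum_k X i k *: beta k) r.
    by rewrite ev_sum; apply: eq_bigr => k _; rewrite evZ.
  apply: (conj_ev_eq C t_rs hr); rewrite evM -hx -Hbeta -rmorphM.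
  have -> : x * b`_i = \sum_k X i k *: b`_k.
    rewrite {1}(coord_vbasis (memvf (x * b`_i))); apply: eq_bigr => k _; congr (_ *: _).
    by rewrite /X mxE /= passmx.vecof_delta lfunE /= mxE.
  by rewrite rmorph_sum ev_sum; apply: eq_bigr => k _; rewrite embZ Hbeta evZ.
pose S : 'M[Kbar]_(n, D) := \matrix_(i, j) ev (beta i) rs`_j.
pose L : 'M[Kbar]_D := diag_mx (\row_j ev h rs`_j).
have XS : map_mx iota X *m S = S *m L.
  apply/matrixP => i j; rewrite mul_mx_diag !mxE.
  have hj : rs`_j \in rs by rewrite mem_nth.
  rewrite mulrC -evM HX //; apply: eq_bigr => k _.
  by rewrite !mxE.
have evb g : exists a : 'I_n -> K, forall r, r \in rs ->
    ev g r = \sum_i iota (a i) * ev (beta i) r.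
  have [y hy] := emb_ex g; exists (fun i => coord b i y) => r hr.
  have -> : \sum_i iota (coord b i y) * ev (beta i) r =
      ev (\sum_i coord b i y *: beta i) r.
    by rewrite ev_sum; apply: eq_bigr => k _; rewrite evZ.
  apply: (conj_ev_eq C t_rs hr); rewrite -hy {1}(coord_vbasis (memvf y)).
  by rewrite rmorph_sum ev_sum; apply: eq_bigr => k _; rewrite embZ Hbeta evZ.
have [_ _ rs_uniq _] := C.
(* Powers of t are combinations of the basis, so a relation between the columns of [S] becomes a
   relation between power sums over [rs]. *)
have S_rank : \rank S = D.
  rewrite -mxrank_tr; apply/eqP; apply: inj_row_free => c cS.
  pose c' r := \sum_(j < D | rs`_j == r) c 0 j.
  have c'E (j : 'I_D) : c' rs`_j = c 0 j.
    rewrite /c' (big_pred1 j) // => k /=.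
    by rewrite nth_uniq.
  have sumE (G : Kbar -> Kbar) : \sum_(r <- rs) c' r * G r = \sum_(j < D) c 0 j * G rs`_j.
    rewrite (big_nth 0) big_mkord.
    by apply: eq_bigr => j _; rewrite c'E.
  have /(power_sums_inj rs_uniq) c0 : forall i, (i < size rs)%N ->
      \sum_(r <- rs) c' r * r ^+ i = 0.
    move=> i _; have [a Ha] := evb 'X^i; rewrite (sumE (fun r => r ^+ i)).
    transitivity (\sum_(j < D) \sum_k iota (a k) * (c 0 j * ev (beta k) rs`_j)).
      apply: eq_bigr => j _; rewrite -(ev_polyXn iota) Ha ?mem_nth // mulr_sumr.
      by apply: eq_bigr => k _; rewrite mulrCA.
    rewrite exchange_big big1 //= => k _; rewrite -mulr_sumr.
    have := congr1 (fun A : 'rV_n => A 0 k) cS; rewrite !mxE => E.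
    rewrite [X in _ * X](_ : _ = 0) ?mulr0 // -[RHS]E.
    by apply: eq_bigr => j _; rewrite !mxE.
  by apply/rowP => j; rewrite mxE -c'E c0 // mem_nth.
have nD : n = D.
  apply/eqP; rewrite eqn_leq subext_dim -S_rank rank_leq_row //.
(* [S] is square only through the equation n = D, so its left and right inverses are obtained
   separately and then identified. *)
have /row_fullP [B BS] : row_full S by rewrite /row_full S_rank.
have /row_freeP [B' SB] : row_free S by rewrite /row_free S_rank nD.
have BB' : B = B' by rewrite -(mulmx1 B) -SB mulmxA BS mul1mx.
rewrite /field_trace -/b -/X -trace_map_mx -[map_mx _ _]mulmx1 -SB mulmxA XS.
rewrite -BB' -mulmxA mxtrace_mulC -mulmxA BS mulmx1 mxtrace_diag.
rewrite (big_nth 0) big_mkord; apply: eq_bigr => j _.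
by rewrite mxE.
Qed.
End Trace.
End SimpleExtensions.

(** By [field_traceE] the sum is the trace of a matrix with entries in K. *)
Lemma trace_rational (K : fieldType) (Kbar : closedFieldType)
    (iota : {rmorphism K -> Kbar}) M rs : conjugates iota M rs ->
  forall h, exists a, \sum_(r <- rs) ev iota h r = iota a.
Proof.
move=> C h; case: rs C => [|t rs] C; first by exists 0; rewrite big_nil rmorph0.
have t_rs : t \in t :: rs by rewrite mem_head.
have [F F_t] := simple_subext C t_rs.
have [x hx] := emb_ex C t_rs F_t h.
by exists (field_trace x); rewrite (field_traceE C t_rs F_t hx).
Qed.

Lemma vge_lower_bound (F : fieldType) (v : F -> \bar rat) n (x : nat -> F) :
  is_valuation v -> exists m, forall i, (i < n)%N -> vge v m (x i).
Proof.
move=> v_val; elim: n => [|n [m Hm]]; first by exists 0.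
exists (Num.min m (valq v (x n))) => i; rewrite ltnS leq_eqVlt => /orP [/eqP ->|/Hm].
  by apply: vge_le (vge_val v_val _); rewrite ge_min lexx orbT.
by apply: vge_le; rewrite ge_min lexx.
Qed.

(** * Invariance of the valuation under conjugation *)

Section ConjugateValuation.
Variables (K : fieldType) (Kbar : closedFieldType) (iota : {rmorphism K -> Kbar}).
Variable v : Kbar -> \bar rat.
Hypothesis v_val : is_valuation v.
Hypothesis K_complete :
  forall u, val_cauchy (v \o iota) u -> exists l, val_converges (v \o iota) u l.
Local Notation ev := (ev iota).
Variables (M : {poly K}) (rs : seq Kbar).
Hypothesis C : conjugates iota M rs.

(** Both values are compared with the coefficients of [h %% M]: [norm_equiv] bounds these from below
    in terms of [ev h r], and they bound [ev h r'] from below. What matters is that [B] does not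
    depend on [h]. *)
Lemma conj_val_bound r r' : r \in rs -> r' \in rs ->
  exists B : rat, forall h q, vge v q (ev h r) -> vge v (q - B) (ev h r').
Proof.
move=> hr hr'.
have [B HB] : exists B : rat, forall (a : nat -> K) q,
    vge v q (\sum_(i < size rs) iota (a i) * r ^+ i) ->
    forall i, (i < size rs)%N -> vge v (q - B) (iota (a i)).
  apply: (norm_equiv v_val K_complete) => a S i hi.
  have [_ _ _ Mmin] := C.
  have sP := size_poly (size rs) a; set P := \poly_(i < _) a i in sP.
  have P0 : P = 0.
    apply/eqP; apply: contraT => P0.
    have /(Mmin _ _ hr)/(dvdp_leq P0) : ev P r = 0.
      rewrite (ev_coef _ _ sP) -[RHS]S; apply: eq_bigr => k _.
      by rewrite coef_poly ltn_ord.
    by rewrite (conj_size C) ltnNge sP.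
  by have := congr1 (fun q : {poly K} => q`_i) P0; rewrite coef_poly hi coef0.
have [m Hm] := vge_lower_bound (size rs) (fun i => r' ^+ i) v_val.
exists (B - m) => h q hq.
have hs := conj_mod_size C h.
have {}HB : forall i, (i < size rs)%N -> vge v (q - B) (iota (h %% M)`_i).
  apply: (HB (fun i => (h %% M)`_i)).
  by rewrite -(ev_coef iota _ hs) (conj_mod C).
rewrite -(conj_mod C _ hr') (ev_coef _ _ hs); apply: vge_sum => // i _.
have -> : q - (B - m) = (q - B) + m by ring.
by have := vgeM v_val (HB _ (ltn_ord i)) (Hm _ (ltn_ord i)).
Qed.

Lemma conj_val_le h r r' : r \in rs -> r' \in rs -> ev h r != 0 ->
  valq v (ev h r) <= valq v (ev h r').
Proof.
move=> hr hr' hr0.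
have hr'0 : ev h r' != 0.
  by apply: contra_neq hr0 => /(conj_ev0 C hr' hr).
have [B HB] := conj_val_bound hr hr'.
rewrite leNgt; apply/negP => lt.
have ab0 : 0 < valq v (ev h r) - valq v (ev h r') by rewrite subr_gt0.
(* Replacing h by h^n multiplies the gap between the two valuations by n but leaves [B]
   unchanged. *)
have [n] := rat_bound (B / (valq v (ev h r) - valq v (ev h r'))).
rewrite ltr_pdivrMr // => Hn.
have h1 : vge v (n%:R * valq v (ev h r)) (ev (h ^+ n) r).
  by rewrite evX; apply/vgeX/vge_val.
have := HB _ _ h1; rewrite evX vgeE // expf_eq0 (negPf hr'0) andbF /= valX //.
move: Hn; move: (valq v _) (valq v _) n%:R => a b c; rewrite mulrBr => h2 h3.
by lra.
Qed.

(* Two norms that are equivalent and multiplicative coincide. *)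
Lemma conj_val h r r' : r \in rs -> r' \in rs -> v (ev h r) = v (ev h r').
Proof.
move=> hr hr'; have [hr0|hr0] := eqVneq (ev h r) 0.
  by rewrite hr0 (conj_ev0 C hr hr' hr0).
have hr'0 : ev h r' != 0.
  by apply: contra_neq hr0 => /(conj_ev0 C hr' hr).
rewrite (v_fin v_val hr0) (v_fin v_val hr'0); congr (_%:E); apply/eqP.
by rewrite eq_le !conj_val_le.
Qed.

End ConjugateValuation.

(** * Reduction modulo the maximal ideal *)

(* What is used of local fields; ls_perfect: the residue field is perfect. *)
Record local_setting (p : nat) (K : fieldType) (Kbar : closedFieldType)
    (iota : {rmorphism K -> Kbar}) (v : Kbar -> \bar rat) (pi : K) : Prop := {
  ls_val : is_valuation v;
  ls_closure : is_algebraic_closure iota;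
  ls_char0 : forall n, n.+1%:R != 0 :> K;
  ls_conj : forall M rs, conjugates iota M rs -> forall h r r',
    r \in rs -> r' \in rs -> v (ev iota h r) = v (ev iota h r');
  ls_int : forall a : K, a != 0 -> exists z : int, valq v (iota a) = z%:~R;
  ls_pi0 : pi != 0;
  ls_pi : valq v (iota pi) = 1;
  ls_prime : prime p;
  ls_p : vge v 1 (p%:R : Kbar);
  ls_perfect : forall x : K, vge v 0 (iota x) ->
    exists y : K, vge v 0 (iota y) /\ vge v 1 (iota (x - y ^+ p)) }.

Section Integrality.
Variables (p : nat) (K : fieldType) (Kbar : closedFieldType).
Variables (iota : {rmorphism K -> Kbar}) (v : Kbar -> \bar rat) (pi : K).
Hypothesis L : local_setting p iota v pi.
Local Notation ev := (ev iota).
Local Notation vge := (vge v).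
Local Notation vgt := (vgt v).
Local Notation valq := (valq v).
Let v_val := ls_val L.

Definition intp (h : {poly K}) : Prop := forall i, vge 0 (iota h`_i).

Lemma intpD h g : intp h -> intp g -> intp (h + g).
Proof. by move=> hh hg i; rewrite coefD rmorphD; apply: vgeD. Qed.

Lemma intpN h : intp h -> intp (- h).
Proof. by move=> hh i; rewrite coefN rmorphN vgeN. Qed.

Lemma intpM h g : intp h -> intp g -> intp (h * g).
Proof.
move=> hh hg i; rewrite coefM rmorph_sum; apply: vge_sum => // j _.
by rewrite rmorphM; apply: vgeMl.
Qed.

Lemma intpC a : vge 0 (iota a) -> intp a%:P.
Proof. by move=> ha i; rewrite coefC; case: eqP => // _; rewrite rmorph0 vge0. Qed.

Lemma intp_sum (I : Type) (s : seq I) (P : pred I) (G : I -> {poly K}) :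
  (forall i, P i -> intp (G i)) -> intp (\sum_(i <- s | P i) G i).
Proof.
move=> H; elim/big_rec: _ => [|i x /H]; last exact: intpD.
by move=> i; rewrite coef0 rmorph0 vge0.
Qed.

Lemma intp1 : intp 1.
Proof. by apply: intpC; rewrite rmorph1 vge1. Qed.

Lemma intpX : intp 'X.
Proof.
move=> i; rewrite coefX; case: (i == 1)%N; first by rewrite rmorph1 vge1.
by rewrite rmorph0 vge0.
Qed.

Lemma intpXn h n : intp h -> intp (h ^+ n).
Proof.
move=> hh; elim: n => [|n IH]; first exact: intp1.
by rewrite exprS; apply: intpM.
Qed.

Lemma intp_comp h g : intp h -> intp g -> intp (h \Po g).
Proof.
move=> hh hg; rewrite comp_polyE; apply: intp_sum => i _.
by rewrite -mul_polyC; apply: intpM; [apply: intpC|apply: intpXn].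
Qed.

Lemma intp_ev h x : intp h -> vge 0 x -> vge 0 (ev h x).
Proof.
move=> hh hx; rewrite (ev_coef iota x (leqnn _)); apply: vge_sum => // i _.
by apply: vgeMl => //; apply: vgeX0.
Qed.

Lemma vgt_int (a : K) : vgt 0 (iota a) -> vge 1 (iota a).
Proof.
rewrite vgtE // vgeE // fmorph_eq0; case: eqVneq => //= a0.
have [z ->] := ls_int L a0.
by rewrite ltr0z -[1]/(1%:~R) ler_int.
Qed.

(** If v(x) < 0, the leading term of h(x) has strictly least valuation, which is negative. *)
Lemma integral_preimage h x : h \is monic -> intp h -> (1 < size h)%N ->
  vge 0 (ev h x) -> vge 0 x.
Proof.
move=> h_monic hh sh1 hhx; rewrite [vge 0 x]vgeE //; case: eqVneq => //= x0.
rewrite leNgt; apply/negP => xlt.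
pose n := (size h).-1.
have sh : size h = n.+1 by rewrite prednK // ltnW.
have n0 : (0 < n)%N by rewrite -ltnS -sh.
have E : ev h x = x ^+ n + \sum_(i < n) iota h`_i * x ^+ i.
  rewrite (ev_coef iota x (leqnn _)) sh big_ord_recr /= addrC; congr (_ + _).
  by rewrite -[n]/(n.+1.-1) -sh -lead_coefE (monicP h_monic) rmorph1 mul1r.
have : vgt (valq (x ^+ n)) (\sum_(i < n) iota h`_i * x ^+ i).
  apply: vgt_sum => // i _; apply: vgtMl => //.
  rewrite vgtE // !valX // expf_eq0 (negPf x0) andbF /=.
  by rewrite ltr_nM2r // ltr_nat.
move/(val_addl v_val (expf_neq0 n x0)); rewrite addrC -E => -[hx0 vhx].
move: hhx; rewrite vgeE // (negPf hx0) /= vhx valX // leNgt.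
by rewrite pmulr_rlt0 ?ltr0n // xlt.
Qed.

Lemma integral_root h x : h \is monic -> intp h -> ev h x = 0 -> vge 0 x.
Proof.
move=> h_monic hh hx; apply: (integral_preimage h_monic hh); last by rewrite hx vge0.
rewrite ltnNge; apply/negP => /size1_polyC hC; move: h_monic hx.
by rewrite hC monicE lead_coefC => /eqP -> /eqP; rewrite ev1 oner_eq0.
Qed.

(* The residue class of x is not a root of a monic polynomial of degree < m. *)
Definition res_free (m : nat) (x : Kbar) : Prop :=
  forall h, h \is monic -> intp h -> (size h <= m)%N -> ~~ vgt 0 (ev h x).

Lemma res_free1 x : res_free 1 x.
Proof.
move=> h h_monic hh /size1_polyC hC; move: h_monic.
by rewrite hC monicE lead_coefC => /eqP ->; rewrite ev1 vgt1F.
Qed.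

Section ResFree.
Variables (m : nat) (x : Kbar).
Hypotheses (x_int : vge 0 x) (x_free : res_free m x).

(** Cut [h] off after its last unit coefficient and divide by that coefficient. The part removed is
    small, so a monic polynomial of degree less than m would kill the residue class of x. *)
Lemma res_free_vgt h : intp h -> (size h <= m)%N -> vgt 0 (ev h x) ->
  forall i, vgt 0 (iota h`_i).
Proof.
move=> hh hm hx i; apply: contraT => hi.
have [||k hk kmax] := @ex_maxnP (fun k => ~~ vgt 0 (iota h`_k)) (size h).
- by exists i.
- by move=> k; apply: contraR; rewrite -ltnNge => /ltnW /(nth_default 0) ->; rewrite rmorph0 vgt0.
have [] := vgt0_unit v_val (hh k) hk; rewrite fmorph_eq0 => a0 va0.
set a := h`_k in a0 va0.
have km : (k < size h)%N.
  by rewrite ltnNge; apply: contra a0 => /(nth_default 0) e; rewrite /a e.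
pose g := a^-1 *: take_poly k.+1 h.
have cg j : g`_j = if (j < k.+1)%N then a^-1 * h`_j else 0.
  by rewrite coefZ coef_take_poly; case: ifP; rewrite ?mulr0.
have hai : vge 0 (iota a^-1).
  by rewrite fmorphV vgeE // valV ?fmorph_eq0 // va0 oppr0 lexx orbT.
have sg : size g = k.+1.
  apply/eqP; rewrite eqn_leq; apply/andP; split.
    by rewrite (leq_trans (size_scale_leq _ _)) // size_take_poly.
  apply: contraT; rewrite -ltnNge ltnS => /(nth_default 0).
  by rewrite cg ltnSn mulVf // => /eqP; rewrite oner_eq0.
have g_monic : g \is monic.
  by rewrite monicE lead_coefE sg cg ltnSn mulVf.
have hg : intp g.
  move=> j; rewrite cg; case: ifP => _; last by rewrite rmorph0 vge0.
  by rewrite rmorphM; apply: vgeMl.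
have := x_free g_monic hg; rewrite sg => /(_ (leq_trans km hm)) /negP [].
rewrite evZ; apply: vgtMl => //.
have -> : ev (take_poly k.+1 h) x = ev h x - ev (drop_poly k.+1 h * 'X^(k.+1)) x.
  by rewrite -{2}(poly_take_drop k.+1 h) evD addrK.
apply: vgtB => //; rewrite evM mulrC; apply: vgtMl => //.
  by rewrite ev_polyXn vgeX0.
rewrite (ev_coef iota x (leqnn _)); apply: vgt_sum => // j _.
rewrite mulrC; apply: vgtMl => //; first exact: vgeX0.
rewrite coef_drop_poly; apply: contraT => /kmax.
by rewrite addnS ltnNge leq_addl.
Qed.

(** Orthogonality of 1, x, ..., x^(m-1) over K. Dividing by the coefficient of least valuation
    reduces it to the residue field. *)
Lemma res_free_vge (h : {poly K}) q : (size h <= m)%N -> vge q (ev h x) ->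
  forall i, vge q (iota h`_i).
Proof.
move=> hm hq i; apply: contraT => hi.
have i_lt : (i < size h)%N.
  by rewrite ltnNge; apply: contra hi => /(nth_default 0) ->; rewrite rmorph0 vge0.
have hi0 : h`_(Ordinal i_lt) != 0 by apply: contra hi => /eqP /= ->; rewrite rmorph0 vge0.
have [k hk0 kmin] := @arg_minP _ _ _ _ (fun k : 'I_(size h) => h`_k != 0)
  (fun k => valq (iota h`_k)) hi0.
have kq : valq (iota h`_k) < q.
  apply: le_lt_trans (kmin _ hi0) _; move: hi.
  by rewrite vgeE // negb_or -ltNge => /andP [].
set a := h`_k in hk0 kmin kq.
have a0 : iota a != 0 by rewrite fmorph_eq0.
have hah : intp (a^-1 *: h).
  move=> j; rewrite coefZ rmorphM fmorphV vgeE // mulf_eq0 invr_eq0 (negPf a0) /=.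
  rewrite fmorph_eq0; case: eqVneq => //= hj0.
  have jlt : (j < size h)%N.
    by rewrite ltnNge; apply: contra hj0 => /(nth_default 0) ->.
  rewrite valM ?invr_eq0 ?fmorph_eq0 // valV // addrC subr_ge0.
  exact: (kmin (Ordinal jlt)).
have := res_free_vgt hah (leq_trans (size_scale_leq _ _) hm).
have hax : vgt 0 (ev (a^-1 *: h) x).
  rewrite evZ fmorphV; apply: (@vge_vgt _ _ 0 (- valq (iota a) + q)).
    by rewrite addrC subr_gt0.
  by apply: vgeM => //; rewrite -valV //; apply: vge_val.
move=> /(_ hax k); rewrite coefZ mulVf // rmorph1.
by rewrite vgt1F.
Qed.

(** By orthogonality v(h(x)) is the least valuation of a coefficient, hence a valuation of an
    element of K. *)
Lemma res_free_int (h : {poly K}) : (size h <= m)%N -> h != 0 ->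
  ev h x != 0 /\ exists z : int, valq (ev h x) = z%:~R.
Proof.
move=> hm h0; have l0 : iota (lead_coef h) != 0 by rewrite fmorph_eq0 lead_coef_eq0.
have hx0 : ev h x != 0.
  apply/eqP => hx0; move/eqP: l0; apply; apply: (vge_inf v_val) => q.
  by rewrite lead_coefE; apply: res_free_vge => //; rewrite hx0 vge0.
split=> //.
have coef_ge i : vge (valq (ev h x)) (iota h`_i).
  by apply: res_free_vge => //; apply: vge_val.
have [i hi] : exists i, ~~ vgt (valq (ev h x)) (iota h`_i).
  apply: contrapT => H.
  have : vgt (valq (ev h x)) (ev h x).
    rewrite {2}(ev_coef iota x (leqnn _)); apply: vgt_sum => // i _.
    rewrite mulrC; apply: vgtMl => //; first exact: vgeX0.
    by apply: contraT => hi; exfalso; apply: H; exists i.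
  by rewrite vgtE // (negPf hx0) ltxx.
have := coef_ge i; move: hi; rewrite vgtE // vgeE // fmorph_eq0.
case: eqVneq => //= hi0; rewrite -leNgt => h1 h2.
have [z ez] := ls_int L hi0; exists z; rewrite -ez; apply/eqP.
by rewrite eq_le h1 h2.
Qed.
End ResFree.

(* mu is a monic polynomial of minimal degree whose reduction kills the residue
   class of t: a lift of the minimal polynomial of that class. *)
Definition res_minpoly (mu : {poly K}) (t : Kbar) : Prop :=
  [/\ mu \is monic, intp mu, vgt 0 (ev mu t) & res_free (size mu).-1 t].

Lemma res_minpoly_ex h t : h \is monic -> intp h -> vgt 0 (ev h t) ->
  exists mu, res_minpoly mu t.
Proof.
move=> h_monic hh ht.
have exn : exists n, `[< exists g, [/\ g \is monic, intp g, vgt 0 (ev g t) & size g = n] >].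
  by exists (size h); apply/asboolP; exists h.
have [n /asboolP [mu [mu_monic mu_int mut smu]] nmin] := ex_minnP exn.
exists mu; split=> // g g_monic hg; rewrite smu => sg; apply/negP => gt.
have : (n <= size g)%N by apply: nmin; apply/asboolP; exists g.
have : (0 < n)%N by rewrite -smu size_poly_gt0 monic_neq0.
by case: (n) sg => // k /= h1 _ h2; move: (leq_trans h2 h1); rewrite ltnn.
Qed.

Lemma monic_division (h : {poly K}) : h \is monic -> intp h -> forall g, intp g ->
  exists q r, [/\ intp q, intp r, g = q * h + r & (size r < size h)%N].
Proof.
move=> h_monic hh g; have [n] := ubnP (size g); elim: n g => // n IH g sg hg.
have [lt|le] := ltnP (size g) (size h).
  exists 0, g; split=> //; last by rewrite mul0r add0r.
  by move=> i; rewrite coef0 rmorph0 vge0.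
have sh0 : (0 < size h)%N by rewrite size_poly_gt0 monic_neq0.
have sg0 : (0 < size g)%N := leq_trans sh0 le.
pose c := lead_coef g *: 'X^(size g - size h).
have hc : intp c.
  by rewrite /c -mul_polyC; apply: intpM; [exact/intpC/hg|apply/intpXn/intpX].
have c0 : lead_coef g != 0 by rewrite lead_coef_eq0 -size_poly_gt0.
have sc : size c = (size g - size h).+1 by rewrite size_scale // size_polyXn.
have sch : size (c * h) = size g.
  rewrite size_Mmonic -?size_poly_gt0 ?sc // addSn subnK //.
have chg : (c * h)`_(size g).-1 = lead_coef g.
  rewrite -sch -lead_coefE lead_coefM (monicP h_monic) mulr1.
  by rewrite lead_coefZ lead_coefXn mulr1.
have [||q [r [hq hr E sr]]] := IH (g - c * h).
- rewrite -ltnS; apply: leq_trans sg; rewrite ltnS -(prednK sg0) ltnS.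
  apply/leq_sizeP => j; rewrite leq_eqVlt => /orP [/eqP <-|lt].
    by rewrite coefB chg -lead_coefE subrr.
  by rewrite coefB !nth_default ?subrr ?sch // -(prednK sg0).
- by apply: intpD => //; apply/intpN/intpM.
exists (c + q), r; split=> //; first exact: intpD.
by rewrite mulrDl -addrA -E addrCA subrr addr0.
Qed.

(* Because mu is irreducible modulo the maximal ideal. *)
Lemma res_minpoly_root mu t c : vge 0 t -> res_minpoly mu t -> ev mu c = 0 ->
  vge 0 c /\ res_free (size mu).-1 c.
Proof.
move=> t_int [mu_monic mu_int mut tfree] mu_c.
have c_int : vge 0 c := integral_root mu_monic mu_int mu_c.
split=> // h h_monic hh sh; apply/negP => hc.
have [nu [nu_monic nu_int nuc cfree]] := res_minpoly_ex h_monic hh hc.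
have snu : (size nu <= (size mu).-1)%N.
  rewrite leqNgt; apply/negP => lt; suff : ~~ vgt 0 (ev h c) by rewrite hc.
  apply: cfree => //.
  by rewrite -ltnS prednK ?size_poly_gt0 ?monic_neq0 // (leq_ltn_trans sh lt).
have smu0 : (0 < size mu)%N by rewrite size_poly_gt0 monic_neq0.
have snu0 : (0 < size nu)%N by rewrite size_poly_gt0 monic_neq0.
(* In the residue field nu divides mu: r kills the class of c and has smaller degree than nu, so its
   coefficients are small. Hence q or nu, both of smaller degree than mu, would kill the class of
   t. *)
have [q [r [hq hr E sr]]] := monic_division nu_monic nu_int mu_int.
have sr' : (size r <= (size nu).-1)%N by rewrite -ltnS prednK.
have r_c : vgt 0 (ev r c).
  have := congr1 (ev^~ c) E; rewrite /= evD evM mu_c => /eqP.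
  rewrite eq_sym addrC addr_eq0 => /eqP ->; rewrite vgtN //.
  by apply: vgtMl => //; apply: intp_ev.
have r_small := res_free_vgt c_int cfree hr sr' r_c.
have q_neq0 : q != 0.
  apply/eqP => q0; have Er : mu = r by rewrite E q0 mul0r add0r.
  by have := leq_trans sr snu; rewrite -Er ltnNge leq_pred.
have sqn' : size (q * nu) = (size q + size nu).-1 by rewrite size_Mmonic.
have sq0 : (0 < size q)%N by rewrite size_poly_gt0.
have sqn : (size r < size (q * nu)%R)%N.
  rewrite sqn'; apply: leq_trans sr _; move: sq0.
  by case: (size q) => // k; rewrite addSn /= leq_addl.
have q_monic : q \is monic.
  rewrite monicE -(monicP mu_monic) E lead_coefDl // lead_coefM.
  by rewrite (monicP nu_monic) mulr1.
have smuE : size mu = (size q + size nu).-1 by rewrite {1}E size_polyDl.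
have snu1 : (1 < size nu)%N.
  rewrite ltnNge; apply/negP => /size1_polyC nuC.
  move: nu_monic nuc; rewrite nuC monicE lead_coefC => /eqP ->.
  by rewrite ev1 vgt1F.
have sq : (size q <= (size mu).-1)%N.
  by rewrite smuE; case: (size nu) snu1 => [|[|k]] //= _; rewrite addnS addnS /= leq_addr.
have r_t : vgt 0 (ev r t).
  rewrite (ev_coef iota t (leqnn _)); apply: vgt_sum => // i _.
  by rewrite mulrC; apply: vgtMl => //; apply: vgeX0.
have : vgt 0 (ev q t * ev nu t).
  by have := vgtB v_val mut r_t; rewrite E evD evM addrK.
case/vgtM0; rewrite ?intp_ev //.
  by apply/negP; apply: tfree.
by apply/negP; apply: tfree.
Qed.
End Integrality.

(** * Value groups *)

(** The class of [a] modulo the integers has order exactly [denq a]. *)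
Lemma denq_separates (a : rat) (i j : nat) (z : int) :
  (i < `|denq a|)%N -> (j < `|denq a|)%N -> i%:R * a - j%:R * a = z%:~R -> i = j.
Proof.
move=> hi hj; rewrite -mulrBl => E.
have E' : (i%:Z - j%:Z) * numq a = z * denq a.
  apply: (@intr_inj rat); rewrite !rmorphM rmorphB /= -E.
  by rewrite numqE mulrA.
have : (denq a %| (i%:Z - j%:Z))%Z.
  rewrite -(@Gauss_dvdzl _ _ (numq a)); first by rewrite E' dvdz_mull.
  by rewrite coprimezE coprime_sym coprime_num_den.
rewrite dvdzE /= => /dvdnP [k].
case: k => [|k]; rewrite ?mul0n ?mulSn => Ek; first by lia.
move: Ek hi hj; set d := `|denq a|%N; set kd := (k * d)%N.
lia.
Qed.

Lemma fact_denq (a : rat) (n : nat) : (`|denq a| <= n)%N ->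
  exists z : int, n`!%:R * a = z%:~R.
Proof.
move=> hn; have d0 : (0 < `|denq a|)%N by rewrite absz_gt0 denq_neq0.
have /dvdnP [k ->] : (`|denq a| %| n`!)%N by rewrite dvdn_fact // d0.
exists (k%:Z * numq a); rewrite natrM [RHS]rmorphM /= -mulrA; congr (_ * _).
by rewrite numqE mulrC -[(`|denq a|)%:R]/((`|denq a|%:Z)%:~R) absz_denq.
Qed.

Lemma ev_rVpoly (K : fieldType) (Kbar : closedFieldType)
    (iota : {rmorphism K -> Kbar}) n (a : 'rV[K]_n) x :
  ev iota (rVpoly a) x = \sum_(i < n) iota (a 0 i) * x ^+ i.
Proof.
rewrite (ev_coef iota x (size_poly _ _)); apply: eq_bigr => i _.
by rewrite coef_rVpoly_ord.
Qed.

Lemma lin_relation (K : fieldType) (Kbar : closedFieldType)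
    (iota : {rmorphism K -> Kbar}) M rs t (T : finType) (B : T -> {poly K}) :
  conjugates iota M rs -> t \in rs -> (size rs < #|T|)%N ->
  exists c : T -> K, (exists i, c i != 0) /\ \sum_i iota (c i) * ev iota (B i) t = 0.
Proof.
move=> C t_rs lt.
pose A : 'M[K]_(#|T|, size rs) := \matrix_k poly_rV (B (enum_val k) %% M).
have : kermx A != 0.
  rewrite kermx_eq0 /row_free; apply: contraTneq lt => <-.
  by rewrite -leqNgt rank_leq_col.
case/rowV0Pn => u /sub_kermxP uA u0.
exists (fun i => u 0 (enum_rank i)); split.
  have /rV0Pn [k hk] := u0; exists (enum_val k); by rewrite enum_valK.
have : \sum_k u 0 k *: (B (enum_val k) %% M) = 0.
  have := congr1 rVpoly uA; rewrite linear0 mulmx_sum_row linear_sum => E; rewrite -[RHS]E.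
  apply: eq_bigr => k _; rewrite linearZ /= rowK poly_rV_K //.
  exact: conj_mod_size C _.
move/(congr1 (ev iota ^~ t)); rewrite /= ev0 ev_sum => E; rewrite -[RHS]E.
rewrite (reindex_onto enum_val enum_rank) /=; last by move=> i _; rewrite enum_rankK.
apply: eq_big => [k|k _]; first by rewrite enum_valK eqxx.
by rewrite evZ (conj_mod C) // enum_valK.
Qed.

Section ValueGroup.
Variables (p : nat) (K : fieldType) (Kbar : closedFieldType).
Variables (iota : {rmorphism K -> Kbar}) (v : Kbar -> \bar rat) (pi : K).
Hypothesis L : local_setting p iota v pi.
Local Notation ev := (ev iota).
Local Notation vge := (vge v).
Local Notation vgt := (vgt v).
Local Notation valq := (valq v).
Let v_val := ls_val L.
Variables (M : {poly K}) (rs : seq Kbar) (t : Kbar).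
Hypotheses (C : conjugates iota M rs) (t_rs : t \in rs) (t_int : vge 0 t).

(* The inequality e f <= n: the products s^i t^j with i < denq (valq s) and j < m
   are linearly independent over K. *)
Lemma denq_bound m g : res_free iota v m t -> ev g t != 0 ->
  (`|denq (valq (ev g t))| * m <= size rs)%N.
Proof.
move=> tfree s0; rewrite leqNgt; apply/negP.
set s := ev g t in s0 *; set e := `|denq _|%N => lt.
have [|c [[i0 ci0]]] := @lin_relation _ _ iota M rs t ('I_e * 'I_m)%type
  (fun ij => g ^+ ij.1 * 'X^(ij.2)) C t_rs.
  by rewrite card_prod !card_ord.
(* Group the relation by powers of s. Each coefficient h_i(t) has integral valuation, so the nonzero
   terms h_i(t) s^i have valuations in distinct classes modulo the integers. *)
pose h i := rVpoly (\row_(j < m) c (i, j)).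
pose x (i : 'I_e) := ev (h i) t * s ^+ i.
have -> : \sum_i iota (c i) * ev (g ^+ i.1 * 'X^(i.2)) t = \sum_i x i.
  transitivity (\sum_i \sum_j iota (c (i, j)) * ev (g ^+ i * 'X^j) t).
    by rewrite pair_bigA; apply: eq_bigr => -[].
  apply: eq_bigr => i _; rewrite /x ev_rVpoly mulr_suml; apply: eq_bigr => j _.
  by rewrite mxE evM evX ev_polyXn -/s mulrCA mulrC.
have hm i : (size (h i) <= m)%N by exact: size_poly.
have h0 i : h i != 0 -> ev (h i) t != 0 /\ exists z : int, valq (ev (h i) t) = z%:~R.
  by apply: (res_free_int L t_int tfree).
have x0 i : x i != 0 -> h i != 0.
  by apply: contra_neq => e0; rewrite /x e0 ev0 mul0r.
move/(sum_distinct_val v_val) => H.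
have {}H : forall i, x i = 0.
  apply: H => i j ij xi xj.
  have [hi [zi ezi]] := h0 i (x0 i xi); have [hj [zj ezj]] := h0 j (x0 j xj).
  rewrite /x !valM ?expf_neq0 // !valX // ezi ezj.
  apply: contra ij => /eqP E; apply/eqP/val_inj => /=.
  apply: (@denq_separates (valq s) _ _ (zj - zi)); rewrite ?ltn_ord //.
  by rewrite rmorphB /=; move: E => /eqP; rewrite -subr_eq0 => /eqP E; lra.
have := H i0.1; rewrite /x => /eqP; rewrite mulf_eq0 expf_eq0 (negPf s0) andbF orbF.
have [e0|/h0 [/negPf ->] //] := eqVneq (h i0.1) 0.
have := congr1 (fun q : {poly K} => q`_i0.2) e0; rewrite coef_rVpoly_ord mxE coef0.
by rewrite -surjective_pairing => e1; rewrite e1 eqxx in ci0.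
Qed.

Lemma val_discrete g : ev g t != 0 ->
  exists z : int, (size rs)`!%:R * valq (ev g t) = z%:~R.
Proof.
move=> s0; apply: fact_denq.
by have := denq_bound (@res_free1 _ _ _ _ _ _ L t) s0; rewrite muln1.
Qed.

(** Multiplied by a common denominator and shifted by the bound [n0], the valuations become natural
    numbers, among which there is a least one. *)
Lemma val_min (P : {poly K} -> Prop) (b : rat) :
  (exists2 h, P h & ev h t != 0) -> (forall h, P h -> vge b (ev h t)) ->
  exists h, [/\ P h, ev h t != 0 & forall g, P g -> vge (valq (ev h t)) (ev g t)].
Proof.
move=> [h0 Ph0 h00] Hb.
pose D : rat := (size rs)`!%:R.
have D0 : 0 < D by rewrite ltr0n fact_gt0.
have [n0 Hn0] := rat_bound (- (D * b)).
have nat_val g : P g -> ev g t != 0 -> exists n : nat, D * valq (ev g t) + n0%:R = n%:R.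
  move=> Pg g0; have [z ez] := val_discrete g0.
  have := Hb g Pg; rewrite vgeE // (negPf g0) /= -(ler_pM2l D0) => hb.
  have : 0 <= (z + n0%:Z)%:~R :> rat by rewrite rmorphD /= -ez; lra.
  rewrite ler0z; case E : (z + n0%:Z) => [n|//] _; exists n.
  by rewrite ez -[n%:R]/((n%:Z)%:~R) -E rmorphD.
have exn : exists n : nat, `[< exists h, [/\ P h, ev h t != 0 &
    D * valq (ev h t) + n0%:R = n%:R] >].
  by have [n En] := nat_val _ Ph0 h00; exists n; apply/asboolP; exists h0.
have [n /asboolP [h [Ph hh0 En]] nmin] := ex_minnP exn.
exists h; split=> // g Pg; rewrite vgeE //; case: eqVneq => //= g0.
have [k Ek] := nat_val _ Pg g0.
have : (n <= k)%N by apply: nmin; apply/asboolP; exists g.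
by rewrite -(ler_nat rat) -En -Ek lerD2r ler_pM2l.
Qed.

End ValueGroup.

(** * Differents *)

Section Codifferent.
Variables (p : nat) (K : fieldType) (Kbar : closedFieldType).
Variables (iota : {rmorphism K -> Kbar}) (v : Kbar -> \bar rat) (pi : K).
Hypothesis L : local_setting p iota v pi.
Local Notation ev := (ev iota).
Local Notation vge := (vge v).
Local Notation vgt := (vgt v).
Local Notation valq := (valq v).
Let v_val := ls_val L.

Definition conj_trace (rs : seq Kbar) (h : {poly K}) : Kbar := \sum_(r <- rs) ev h r.

(* Elements of K(t) are represented by polynomials over K: h(t) is in the
   codifferent, rs being the conjugates of t. *)
Definition in_codiff (rs : seq Kbar) (t : Kbar) (h : {poly K}) : Prop :=
  forall g, vge 0 (ev g t) -> vge 0 (conj_trace rs (h * g)).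

(* E is the valuation of the different of K(t): the codifferent is generated by an
   element c(t) of valuation -E. *)
Definition diff_val (rs : seq Kbar) (t : Kbar) (E : rat) : Prop :=
  (exists c, [/\ in_codiff rs t c, ev c t != 0 & valq (ev c t) = - E]) /\
  forall h, in_codiff rs t h -> vge (- E) (ev h t).

Section OneLevel.
Variables (M : {poly K}) (rs : seq Kbar) (t : Kbar).
Hypotheses (C : conjugates iota M rs) (t_rs : t \in rs) (t_int : vge 0 t).

Lemma conj_vge q h r : r \in rs -> vge q (ev h t) -> vge q (ev h r).
Proof. by move=> hr; rewrite (eq_vge _ (ls_conj L C h hr t_rs)). Qed.

Lemma conj_trace_eq h g : ev h t = ev g t -> conj_trace rs h = conj_trace rs g.
Proof.
move=> e; rewrite /conj_trace big_seq [RHS]big_seq; apply: eq_bigr => r hr.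
by have := conj_ev_eq C t_rs hr e.
Qed.

Lemma conj_trace_int h : vge 0 (ev h t) -> vge 0 (conj_trace rs h).
Proof.
by move=> hh; apply: vge_sum_seq => // r hr _; apply: conj_vge.
Qed.

Lemma in_codiff_vge E h : diff_val rs t E -> vge (- E) (ev h t) -> in_codiff rs t h.
Proof.
move=> [[c [hc c0 Ec]] _] hh g hg.
have [k Ek] := conj_inv C t_rs c0.
rewrite (@conj_trace_eq _ (c * (k * h * g))); last first.
  by rewrite !evM Ek mulrA mulVKf.
apply: hc; rewrite !evM Ek.
apply: vgeMr => //.
have := vgeM v_val (vge_val v_val (ev c t)^-1) hh.
by rewrite valV // Ec opprK subrr.
Qed.

(** The codifferent has bounded poles: if v(h(t)) < -n, then pi^-n / h(t) is integral, so the trace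
    of pi^-n would be integral; but this trace is D pi^-n, D being the degree, and n > v(D).
    Discreteness then provides a generator. *)
Lemma diff_val_ex : exists E, diff_val rs t E.
Proof.
have cod1 : in_codiff rs t 1 by move=> g hg; rewrite mul1r; apply: conj_trace_int.
have rs0 : (0 < size rs)%N by case: (rs) t_rs.
have D0 : (size rs)%:R != 0 :> K by rewrite -(prednK rs0) (ls_char0 L).
have [n Hn] := rat_bound (valq (iota (size rs)%:R)).
have bd h : in_codiff rs t h -> vge (- n%:R) (ev h t).
  move=> hh; rewrite vgeE //; case: eqVneq => //= h0; rewrite leNgt; apply/negP => lt.
  have [k Ek] := conj_inv C t_rs h0.
  have pi0 := ls_pi0 L.
  have ipi : iota (pi ^- n) != 0 by rewrite fmorph_eq0 invr_eq0 expf_neq0.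
  have vpi : valq (iota (pi ^- n)) = - n%:R.
    by rewrite fmorphV rmorphXn valV ?expf_neq0 ?fmorph_eq0 // valX ?fmorph_eq0 // (ls_pi L) mulr1.
  have hg : vge 0 (ev (k * (pi ^- n)%:P) t).
    rewrite evM Ek evC.
    apply: vge_le (vgeM v_val (vge_val v_val (ev h t)^-1) (vge_val v_val (iota (pi ^- n)))).
    by rewrite valV // vpi; lra.
  have := hh _ hg; rewrite (@conj_trace_eq _ (pi ^- n)%:P); last by rewrite !evM Ek mulVKf.
  rewrite /conj_trace; under eq_bigr do rewrite evC.
  rewrite big_const_seq count_predT iter_addr_0 -mulr_natr -(rmorph_nat iota).
  rewrite vgeE // mulf_eq0 (negPf ipi) fmorph_eq0 (negPf D0) /=.
  rewrite valM ?fmorph_eq0 ?invr_eq0 ?expf_neq0 //.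
  by rewrite vpi => H; lra.
have [|c [hc c0 cmin]] := val_min L C t_rs t_int _ bd.
  by exists 1; rewrite // ev1 oner_eq0.
exists (- valq (ev c t)); split; last by rewrite opprK.
by exists c; rewrite opprK.
Qed.

(** The different is the inverse ideal of the codifferent, so 1 / c(t) generates it. *)
Lemma diff_valE E : diff_val rs t E -> is_val_different iota v (adjoin iota t) E.
Proof.
move=> hE; have [[c [hc c0 Ec]] codE] := hE.
have [F F_t] := simple_subext C t_rs.
exists F; split=> //.
have codP (x : F) h : subext_emb F x = ev h t -> codifferent v x <-> in_codiff rs t h.
  move=> ex; split=> [hx g hg|hx y hy].
    have [y ey] := emb_ex C t_rs F_t g.
    have := hx y; rewrite /ring_of_integers /subext_val /= ey => /(_ hg).
    by rewrite (@field_traceE _ _ _ _ _ _ C t_rs F F_t (x * y) (h * g)) // rmorphM evM ex ey.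
  have [g ey] := emb_ev C t_rs F_t y.
  rewrite /ring_of_integers /=.
  rewrite (@field_traceE _ _ _ _ _ _ C t_rs F F_t (x * y) (h * g)); last first.
    by rewrite rmorphM evM ex ey.
  by apply: hx; rewrite -ey.
have [k Ek] := conj_inv C t_rs c0.
have [delta ed] := emb_ex C t_rs F_t k.
have [c' ec'] := emb_ex C t_rs F_t c.
exists delta; last first.
  rewrite /subext_val /= ed Ek (v_fin v_val) ?invr_eq0 //.
  by rewrite valV // Ec opprK.
rewrite /generates; apply/seteqP; split=> x.
  move=> hx; exists (x * c').
    exact/hx/(codP _ _ ec').
  apply: (fmorph_inj (subext_emb F)); rewrite !rmorphM ed ec' Ek mulrCA.
  by rewrite mulVf ?mulr1.
move=> [y hy <-] z hz; have [g eg] := emb_ev C t_rs F_t z.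
have /codE hg : in_codiff rs t g by apply/(codP _ _ eg).
rewrite /ring_of_integers /subext_val /= !rmorphM ed Ek eg -/(vge 0 _).
rewrite mulrAC; apply: vgeMr => //.
have := vgeM v_val (vge_val v_val (ev c t)^-1) hg.
by rewrite valV // Ec opprK subrr.
Qed.

End OneLevel.
End Codifferent.

(** * The relative trace from K(t) to K(t') *)

Section Tower.
Variables (p : nat) (K : fieldType) (Kbar : closedFieldType).
Variables (iota : {rmorphism K -> Kbar}) (v : Kbar -> \bar rat) (pi : K).
Hypothesis L : local_setting p iota v pi.
Local Notation ev := (ev iota).
Local Notation vge := (vge v).
Local Notation vgt := (vgt v).
Local Notation valq := (valq v).
Let v_val := ls_val L.

Variables (M : {poly K}) (rs : seq Kbar) (t : Kbar).
Hypotheses (C : conjugates iota M rs) (t_rs : t \in rs).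
Variables (M' : {poly K}) (rs' : seq Kbar) (t' : Kbar).
Hypotheses (C' : conjugates iota M' rs') (t'_rs' : t' \in rs') (t'_int : vge 0 t').
Variable phi : {poly K}.
Hypothesis phi_t : ev phi t = t'.

Lemma conj_restrict r : r \in rs -> ev phi r \in rs'.
Proof.
move=> hr; rewrite (conj_root C') -ev_comp; apply/eqP.
apply: (conj_ev0 C t_rs hr); rewrite ev_comp phi_t; apply/eqP.
by rewrite -(conj_root C').
Qed.

Definition rel_trace (h : {poly K}) : Kbar := \sum_(r <- rs | ev phi r == t') ev h r.

(** The second clause is transitivity of the trace together with linearity over K(t'): [w \Po phi]
    represents w(t') as an element of K(t). *)
Lemma rel_trace_tower h : exists g, ev g t' = rel_trace h /\
  forall w, conj_trace iota rs (h * (w \Po phi)) = conj_trace iota rs' (g * w).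
Proof.
have [g Hg] := relative_trace C C' conj_restrict (trace_rational C) (trace_rational C') h.
exists g; split=> [|w]; first exact: Hg.
have [_ _ u' _] := C'.
rewrite /conj_trace (sum_fibers _ u' conj_restrict) big_seq [RHS]big_seq.
apply: eq_bigr => r' hr'; rewrite evM Hg // mulr_suml.
by apply: eq_bigr => r /eqP <-; rewrite evM ev_comp.
Qed.

Lemma rel_trace_vge q h : vge q (ev h t) -> vge q (rel_trace h).
Proof. by move=> hh; apply: vge_sum_seq => // r hr _; apply: (conj_vge L C t_rs). Qed.

Variables E E' : rat.
Hypotheses (HE : diff_val iota v rs t E) (HE' : diff_val iota v rs' t' E').

(** The relative trace preserves integrality, so the codifferent of K(t') is contained in that of
    K(t). *)
Lemma diff_val_le : E' <= E.
Proof.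
have [[c [hc c0 Ec]] _] := HE'; have [_ codE] := HE.
have : in_codiff iota v rs t (c \Po phi).
  move=> g hg; have [w [ew Hw]] := rel_trace_tower g.
  rewrite mulrC Hw mulrC; apply: hc.
  by rewrite ew; apply: rel_trace_vge.
move/codE; rewrite ev_comp phi_t vgeE // (negPf c0) Ec /=.
by rewrite lerN2.
Qed.

(* Otherwise the codifferent of K(t) could be enlarged by the inverse of a
   uniformizer of K(t'). *)
Lemma rel_trace_lower : exists y, [/\ vge (- E) (ev y t), rel_trace y != 0
  & valq (rel_trace y) <= - E'].
Proof.
apply: contrapT => nH.
have small y : vge (- E) (ev y t) -> vgt (- E') (rel_trace y).
  move=> hy; rewrite vgtE //; case: eqVneq => //= y0.
  by rewrite ltNge; apply/negP => le; apply: nH; exists y.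
have [[c [hc c0 Ec]] codE] := HE; have [[c' [hc' c'0 Ec']] _] := HE'.
(* [w] represents a uniformizer of K(t'), an element of least positive valuation; [pi] witnesses
   that positive valuations occur. *)
have [|w [w_pos w0 wmin]] := @val_min _ _ _ _ _ _ L _ _ _ C' t'_rs' t'_int
    (fun h => vgt 0 (ev h t')) 0 _ (fun h => @vgtW _ _ _ _).
  exists pi%:P; rewrite evC ?fmorph_eq0 ?(ls_pi0 L) //.
  by rewrite vgtE // (ls_pi L) ltr01 orbT.
have [w' Ew'] := conj_inv C' t'_rs' w0.
have [k Ek] := conj_inv C' t'_rs' c'0.
have cod : in_codiff iota v rs t (c * (w' \Po phi)).
  move=> g hg; have [u [eu Hu]] := rel_trace_tower (c * g).
  rewrite mulrAC Hu; suff : in_codiff iota v rs' t' (u * w').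
    by move/(_ 1); rewrite mulr1 ev1; apply; apply: vge1.
  apply: (in_codiff_vge L C' t'_rs' HE').
  have /small tau : vge (- E) (ev (c * g) t).
    by rewrite evM -Ec; apply: vgeMr => //; apply: vge_val.
  (* Minimality of v(w) improves v(u) > -E' to v(u) >= -E' + v(w), so u / w still lies in the
     codifferent of K(t'). *)
  have hk : vge (valq (ev w t')) (ev (u * k) t').
    apply: wmin; rewrite evM eu Ek; move: tau.
    rewrite !vgtE // mulf_eq0 invr_eq0 (negPf c'0) orbF.
    case: eqVneq => //= u0 h; rewrite valM ?invr_eq0 // valV // Ec'; lra.
  have -> : ev (u * w') t' = ev (u * k) t' * ev c' t' * (ev w t')^-1.
    by rewrite !evM Ew' Ek divfK.
  have := vgeM v_val (vgeM v_val hk (vge_val v_val (ev c' t')))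
     (vge_val v_val (ev w t')^-1).
  by rewrite valV // Ec' addrAC subrr add0r.
have := codE _ cod; rewrite evM ev_comp phi_t Ew' vgeE // mulf_eq0 invr_eq0.
rewrite (negPf c0) (negPf w0) /= valM ?invr_eq0 // valV // Ec.
by move: w_pos; rewrite vgtE // (negPf w0) /= => h1 h2; lra.
Qed.

(* With Tr z = 1 and u = b ^ P up to valuation 1, additivity of the P-th power
   modulo p gives u = u (Tr z) ^ P = Tr (z b) ^ P. *)
Lemma frobenius_descent (u b : {poly K}) k :
  vge 0 (ev u t') -> vge 0 (ev b t) ->
  (forall r, r \in rs -> vge 1 (ev u (ev phi r) - ev b r ^+ (p ^ k))) ->
  exists s, vge (1 - (p ^ k)%:R * (E - E')) (ev u t' - ev s t' ^+ (p ^ k)).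
Proof.
move=> hu hb hub; set P := (p ^ k)%N in hub *.
have [y [hy tau0 vtau]] := rel_trace_lower.
have [g [eg _]] := rel_trace_tower (b * y).
have [w [ew _]] := rel_trace_tower y.
have w0 : ev w t' != 0 by rewrite ew.
have [w' ew'] := conj_inv C' t'_rs' w0.
(* This is Tr(b y) / Tr(y), that is, Tr(z b) for z = y / Tr(y). *)
exists (g * w').
pose s := [seq r <- rs | ev phi r == t'].
have hs r : r \in s -> (r \in rs) /\ ev phi r = t'.
  by rewrite mem_filter => /andP [/eqP -> ->].
have Etau : rel_trace y = \sum_(r <- s) ev y r by rewrite big_filter.
have ES : rel_trace (b * y) = \sum_(r <- s) ev (b * y) r by rewrite big_filter.
(* The error 1 - P E comes from y and b y having valuation at least -E. Dividing by Tr(y)^P, of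
   valuation at most -P E', gives the error announced. *)
pose a := 1 + P%:R * (- E).
have hys r : r \in s -> vge (- E) (ev y r).
  by case/hs => hr _; apply: (conj_vge L C t_rs).
have hbys r : r \in s -> vge (- E) (ev (b * y) r).
  case/hs => hr _; apply: (conj_vge L C t_rs) => //.
  by rewrite evM; apply: vgeMl.
have F1 := freshman v_val (ls_prime L) (ls_p L) k hys.
have F2 := freshman v_val (ls_prime L) (ls_p L) k hbys.
rewrite -/P -/a -Etau in F1; rewrite -/P -/a -ES in F2.
have main : vge a (ev u t' * rel_trace y ^+ P - rel_trace (b * y) ^+ P).
  apply: (@vge_trans _ _ v_val _ (ev u t' * \sum_(r <- s) ev y r ^+ P)).
    by rewrite -mulrBr; apply: vgeMl.
  apply: (@vge_trans _ _ v_val _ (\sum_(r <- s) ev (b * y) r ^+ P)); last first.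
    by rewrite vgeBC.
  rewrite mulr_sumr -sumrB; apply: vge_sum_seq => // r hr _.
  rewrite evM exprMn -mulrBl; apply: vgeM => //.
    by have [hr' <-] := hs r hr; apply: hub.
  by apply: vgeX => //; apply: hys.
have -> : ev u t' - ev (g * w') t' ^+ P =
    (ev u t' * rel_trace y ^+ P - rel_trace (b * y) ^+ P) * (rel_trace y ^- P).
  rewrite evM eg ew' ew exprMn exprVn mulrBl mulfK ?expf_neq0 //.
apply: vge_le (vgeM v_val main (vge_val v_val _)).
rewrite valV ?expf_neq0 // valX // /a.
have : P%:R * valq (rel_trace y) <= P%:R * (- E') by apply: ler_wpM2l; rewrite ?ler0n.
by move: (valq _) => z; lra.
Qed.

End Tower.

(** * Iterates of f and the Frobenius map *)

Section FrobeniusLift.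
Variables (p : nat) (K : fieldType) (Kbar : closedFieldType).
Variables (iota : {rmorphism K -> Kbar}) (v : Kbar -> \bar rat) (pi : K).
Hypothesis L : local_setting p iota v pi.
Local Notation ev := (ev iota).
Local Notation vge := (vge v).
Local Notation vgt := (vgt v).
Local Notation valq := (valq v).
Local Notation intp := (intp iota v).
Let v_val := ls_val L.
Let p_prime := ls_prime L.

(** Otherwise a Bezout relation between n and p would put 1 into the maximal ideal. *)
Lemma vgt_natr n : vgt 0 (n%:R : Kbar) -> (p %| n)%N.
Proof.
move=> hn; apply: contraT => pn; rewrite -prime_coprime // in pn.
have [n0|n0] := posnP n.
  by move: pn; rewrite n0 /coprime gcdn0 gtn_eqF // prime_gt1.
have [a b E _] := egcdnP p n0.
move: pn; rewrite coprime_sym /coprime => /eqP g1; rewrite g1 in E.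
suff : vgt 0 (1 : Kbar) by rewrite vgt1F.
have -> : 1 = a%:R * n%:R - b%:R * p%:R :> Kbar.
  by rewrite -!natrM E natrD addrC addKr.
apply: vgtB => //; apply: vgtMl => //; rewrite ?vge_natr //.
exact: vge_vgt (ls_p L).
Qed.

Definition deriv_small (f : {poly K}) : Prop := forall i, vgt 0 (iota (f^`())`_i).

(** The coefficient i f_i of f' is small while i is a unit. So modulo the maximal ideal f is a
    polynomial in X^p. *)
Lemma coef_small f i : intp f -> deriv_small f -> ~~ (p %| i)%N -> vge 1 (iota f`_i).
Proof.
move=> hf hf'; case: i => [|i] pi'; first by rewrite dvdn0 in pi'.
apply: (vgt_int L); have := hf' i; rewrite coef_deriv -mulr_natr rmorphM rmorph_nat.
case/vgtM0 => //; first exact: vge_natr.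
by move/vgt_natr; rewrite (negPf pi').
Qed.

Lemma sum_multiples (c : nat -> Kbar) m :
  (forall i, ~~ (p %| i)%N -> vge 1 (c i)) ->
  vge 1 (\sum_(i < p * m) c i - \sum_(i < m) c (p * i)%N).
Proof.
move=> hc; elim: m => [|m IH]; first by rewrite muln0 !big_ord0 subrr vge0.
rewrite mulnSr big_split_ord /= big_ord_recr /= opprD addrACA; apply: vgeD => //.
have p0 := prime_gt0 p_prime.
rewrite -(big_mkord xpredT (fun i => c (p * m + i)%N)) big_ltn // addn0.
rewrite addrC addKr big_nat; apply: vge_sum => // i /andP [i0 ip]; apply: hc.
by rewrite dvdn_addr ?dvdn_mulr // gtnNdvd.
Qed.

(** The reduction of f is a polynomial in X^p over a perfect field; p-th roots of its coefficients
    give g. The size bound and the congruences between coefficients serve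
    [res_minpoly_separable]. *)
Lemma frobenius_root f : intp f -> deriv_small f -> exists g : {poly K},
  [/\ intp g, (size g <= ((size f).-1 %/ p).+1)%N,
      forall i, vge 1 (iota (f`_(p * i) - g`_i ^+ p))
    & forall x, vge 0 x -> vge 1 (ev f x - ev g x ^+ p)].
Proof.
move=> hf hf'; have p0 := prime_gt0 p_prime.
have /choice [root Hroot] : forall i, exists y, vge 0 (iota y) /\
    vge 1 (iota (f`_(p * i) - y ^+ p)).
  by move=> i; apply: (ls_perfect L).
pose m := ((size f).-1 %/ p).+1.
have fm i : (m <= i)%N -> f`_(p * i) = 0.
  move=> mi; apply: nth_default; apply: leq_trans (leqSpred _) _.
  by rewrite mulnC -ltn_divLR.
pose g := \poly_(i < m) root i.
have gi i : vge 1 (iota (f`_(p * i) - g`_i ^+ p)).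
  rewrite coef_poly; case: ltnP => [_|/fm ->]; first by case: (Hroot i).
  by rewrite expr0n gtn_eqF // subrr rmorph0 vge0.
have g_int : intp g.
  move=> i; rewrite coef_poly; case: ifP => _; first by case: (Hroot i).
  by rewrite rmorph0 vge0.
exists g; split=> //; first exact: size_poly.
move=> x hx.
have sf : (size f <= p * m)%N.
  by apply: leq_trans (leqSpred _) _; rewrite mulnC ltn_ceil.
rewrite (ev_coef iota x sf) (ev_coef iota x (size_poly _ _)).
pose c i := iota f`_i * x ^+ i.
apply: (@vge_trans _ _ v_val _ (\sum_(i < m) c (p * i)%N)).
  apply: (@sum_multiples c m) => i pi'; rewrite /c; apply: vgeMr => //.
    exact: coef_small.
  exact: vgeX0.
apply: (@vge_trans _ _ v_val _ (\sum_(i < m) (iota g`_i * x ^+ i) ^+ p)).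
  rewrite -sumrB; apply: vge_sum => // i _.
  rewrite /c exprMn -exprM [(i * p)%N]mulnC -mulrBl -rmorphXn -rmorphB.
  by apply: vgeMr => //; apply: vgeX0.
rewrite vgeBC //.
have := @freshman1 _ v v_val p p_prime (ls_p L) _ (index_enum 'I_m)
  (fun i : 'I_m => iota g`_i * x ^+ i) 0.
rewrite mulr0 addr0; apply=> i _.
by apply: vgeMl => //; apply: vgeX0.
Qed.

(** Take b = w o g, where g^p is congruent to f and the coefficients of w are p-th roots of those of
    u modulo the maximal ideal. *)
Lemma frobenius_comp f u : intp f -> deriv_small f -> intp u -> exists b, intp b /\
  forall x, vge 0 x -> vge 1 (ev u (ev f x) - ev b x ^+ p).
Proof.
move=> hf hf' hu; have [g [hg _ _ Hg]] := frobenius_root hf hf'.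
have /choice [root Hroot] : forall i, exists y, vge 0 (iota y) /\
    vge 1 (iota (u`_i - y ^+ p)).
  by move=> i; apply: (ls_perfect L).
pose w := \poly_(i < size u) root i.
have hw : intp w.
  move=> i; rewrite coef_poly; case: ifP => _; first by case: (Hroot i).
  by rewrite rmorph0 vge0.
exists (w \Po g); split=> [|x hx]; first exact: (intp_comp L).
have hfx : vge 0 (ev f x) by apply: (intp_ev L).
have hgx : vge 0 (ev g x) by apply: (intp_ev L).
rewrite ev_comp (ev_coef iota _ (leqnn (size u))) (ev_coef iota _ (size_poly _ _)).
apply: (@vge_trans _ _ v_val _ (\sum_(i < size u) (iota w`_i * ev g x ^+ i) ^+ p)).
  rewrite -sumrB; apply: vge_sum => // i _; rewrite exprMn -exprM mulnC exprM.
  apply: (@vge_trans _ _ v_val _ (iota w`_i ^+ p * ev f x ^+ i)).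
    rewrite -mulrBl -rmorphXn -rmorphB coef_poly ltn_ord.
    by apply: vgeMr => //; [case: (Hroot i)|exact: vgeX0].
  rewrite -mulrBr; apply: vgeMl => //; first by apply: vgeX0 => //; apply: hw.
  by apply: vge_subX0 => //; [exact: vgeX0|exact: Hg].
rewrite vgeBC //.
have := @freshman1 _ v v_val p p_prime (ls_p L) _ (index_enum 'I_(size u))
  (fun i : 'I_(size u) => iota w`_i * ev g x ^+ i) 0.
rewrite mulr0 addr0; apply=> i _.
by apply: vgeMl => //; apply: vgeX0.
Qed.

Definition fiter (f : {poly K}) k : {poly K} := iter k (fun h => h \Po f) 'X.

Lemma ev_fiterS f k x : ev (fiter f k.+1) x = ev (fiter f k) (ev f x).
Proof. by rewrite /fiter iterS ev_comp. Qed.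

Lemma ev_fiterSr f k x : ev (fiter f k.+1) x = ev f (ev (fiter f k) x).
Proof.
elim: k x => [|k IH] x; first by rewrite /fiter iterS /= !ev_comp !ev_polyX.
by rewrite ev_fiterS IH -ev_fiterS.
Qed.

Lemma intp_fiter f k : intp f -> intp (fiter f k).
Proof.
by move=> hf; elim: k => [|k IH]; [exact: (intpX L)|apply: (intp_comp L)].
Qed.

(** Each further composition with f extracts one more p-th root; congruences modulo valuation 1 are
    kept when raised to powers. *)
Lemma frobenius_iter f k u : intp f -> deriv_small f -> intp u -> exists b, intp b /\
  forall x, vge 0 x -> vge 1 (ev u (ev (fiter f k) x) - ev b x ^+ (p ^ k)).
Proof.
move=> hf hf' hu; elim: k => [|k [b [hb IH]]].
  by exists u; split=> // x hx; rewrite ev_polyX expr1 subrr vge0.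
have [c [hc Hc]] := frobenius_comp hf hf' hb; exists c; split=> // x hx.
have hfx : vge 0 (ev f x) by apply: (intp_ev L).
rewrite ev_fiterS expnS exprM; apply: (@vge_trans _ _ v_val _ (ev b (ev f x) ^+ (p ^ k))).
  exact: IH.
apply: vge_subX0 => //; [by apply: (intp_ev L)| |exact: Hc].
by apply: vgeX0 => //; apply: (intp_ev L).
Qed.

Lemma intp_deriv f : intp f -> intp f^`().
Proof. by move=> hf i; rewrite coef_deriv rmorphMn; apply: vge_nat. Qed.

(** Building the remainder by induction on f keeps it integral, with no division by factorials. *)
Lemma taylor2 f x y : intp f -> vge 0 x -> vge 0 y -> exists q,
  vge 0 q /\ ev f x - ev f y = ev f^`() y * (x - y) + q * (x - y) ^+ 2.
Proof.
elim/poly_ind: f => [|f a IH] hf hx hy.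
  by exists 0; rewrite deriv0 !ev0 subrr !mul0r addr0; split=> //; apply: vge0.
have {}hf : intp f.
  by move=> i; have := hf i.+1; rewrite coefD coefMX coefC /= addr0.
have [q [hq E]] := IH hf hx hy.
exists (q * x + ev f^`() y); split.
  by apply: vgeD => //; [exact: vgeMl|apply: (intp_ev L) => //; exact: intp_deriv].
rewrite derivD derivM derivX derivC addr0 mulr1 !evE.
transitivity ((ev f x - ev f y) * x + ev f y * (x - y)); first by ring.
by rewrite E; ring.
Qed.

(** The linear term gains v(f'(y)) >= 1, and the quadratic term has valuation 2a >= a + 1 because a
    >= 1. Hence the need for v(t_n - c) >= 1 rather than mere positivity. *)
Lemma contraction f x y a : intp f -> deriv_small f -> vge 0 x -> vge 0 y ->
  1 <= a -> vge a (x - y) -> vge (a + 1) (ev f x - ev f y).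
Proof.
move=> hf hf' hx hy a1 hxy; have [q [hq ->]] := taylor2 hf hx hy.
apply: vgeD => //.
  rewrite addrC; apply: vgeM => //.
  rewrite (ev_coef iota y (leqnn _)); apply: vge_sum => // i _.
  by apply: vgeMr => //; [exact: (vgt_int L)|exact: vgeX0].
apply: vgeMl => //; apply: vge_le (vgeX v_val 2 hxy).
by lra.
Qed.

Lemma contraction_iter f x y k : intp f -> deriv_small f -> vge 0 x -> vge 0 y ->
  vge 1 (x - y) -> vge (k.+1)%:R (ev (fiter f k) x - ev (fiter f k) y).
Proof.
move=> hf hf' hx hy hxy; elim: k => [|k IH]; first by rewrite !ev_polyX.
rewrite !ev_fiterSr -natr1; apply: contraction => //.
- by apply: (intp_ev L) => //; apply: intp_fiter.
- by apply: (intp_ev L) => //; apply: intp_fiter.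
- by rewrite ler1n.
Qed.

(* Otherwise mu would be, modulo the maximal ideal, the p-th power of a polynomial
   of smaller degree, the residue field being perfect. *)
Lemma res_minpoly_separable mu t : vge 0 t -> res_minpoly iota v mu t ->
  ~~ vgt 0 (ev mu^`() t).
Proof.
move=> t_int [mu_monic mu_int mut tfree]; apply/negP => dmut.
have smu0 : (0 < size mu)%N by rewrite size_poly_gt0 monic_neq0.
pose m := (size mu).-1.
have mu_m : mu`_m = 1 by rewrite -(monicP mu_monic) lead_coefE.
have m0 : (0 < m)%N.
  rewrite lt0n; apply/eqP => m0.
  have s1 : (size mu <= 1)%N by rewrite -(prednK smu0) -/m m0.
  have e0 : mu`_0 = 1 by rewrite -[in LHS]m0.
  have mu1 : mu = 1 by rewrite (size1_polyC s1) e0.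
  by move: mut; rewrite mu1 ev1 vgt1F.
have sd : (size mu^`() <= m)%N.
  by rewrite -ltnS prednK // lt_size_deriv // monic_neq0.
have small : deriv_small mu.
  exact: (res_free_vgt L t_int tfree (intp_deriv mu_int) sd dmut).
have pm : (p %| m)%N.
  apply: contraT => npm; have := coef_small mu_int small npm.
  by rewrite mu_m rmorph1 vgeE // oner_eq0 val1 // ler10.
have [g [hg sg Hg Eg]] := frobenius_root mu_int small.
have gt : vgt 0 (ev g t).
  apply: (vgtX0 v_val _ (n := p)); first exact: (intp_ev L).
  rewrite -[_ ^+ p](subKr (ev mu t)); apply: vgtB => //.
  by apply: (vge_vgt _ (Eg t t_int)).
have sgm : (size g <= m)%N.
  apply: leq_trans sg _; rewrite -/m -(leq_pmul2r (prime_gt0 p_prime)).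
  rewrite mulSn divnK //; have := dvdn_leq m0 pm; have := prime_gt1 p_prime.
  by move: (m) => k; nia.
(* The coefficient of index m / p of g is small, since g kills the class of t with degree less than
   m; yet its p-th power is congruent to the leading coefficient 1 of mu. *)
have := res_free_vgt L t_int tfree hg sgm gt (m %/ p).
have := Hg (m %/ p)%N; rewrite mulnC divnK // mu_m rmorphB rmorph1 rmorphXn => h1 h2.
have : vgt 0 (1 : Kbar); last by rewrite vgt1F.
rewrite -[1](subrK (iota g`_(m %/ p) ^+ p)); apply: vgtD => //.
  exact: vge_vgt h1.
rewrite -[X in _ ^+ X](prednK (prime_gt0 p_prime)) exprSr; apply: vgtMl => //.
by apply: vgeX0 => //; apply: hg.
Qed.

(* If Q'(t) is a unit, then only one of the factors t - c is not. *)
Lemma near_root (cs : seq Kbar) t (Q := \prod_(c <- cs) ('X - c%:P)) :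
  vge 0 t -> (forall c, c \in cs -> vge 0 c) ->
  [/\ vge 0 Q.[t], vge 0 Q^`().[t] & ~~ vgt 0 Q^`().[t] ->
     exists2 c, c \in cs & forall q, vge q Q.[t] -> vge q (t - c)].
Proof.
rewrite {}/Q => ht; elim: cs => [|c cs IH] hcs.
  by rewrite big_nil derivC !hornerC vgt0 // vge0 // vge1.
have htc : vge 0 (t - c) by apply: vgeB => //; apply: hcs; rewrite mem_head.
have {IH} [|hQ hdQ IH] := IH.
  by move=> c' h; apply: hcs; rewrite in_cons h orbT.
rewrite big_cons; move: hQ hdQ IH; set Q := \prod_(d <- cs) _ => hQ hdQ IH.
rewrite derivM derivXsubC mul1r hornerD !hornerM hornerXsubC.
split; [exact: vgeMl|by apply: vgeD => //; apply: vgeMl|].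
case: (boolP (vgt 0 Q.[t])) => [hQt|hQt _].
  case: (boolP (vgt 0 (t - c))) => [htc0|htc0].
    by move=> /negP []; apply: vgtD => //; rewrite mulrC; apply: vgtMl.
  case: (boolP (vgt 0 Q^`().[t])) => [hd|/IH [d d_cs Hd] _].
    by move=> /negP []; apply: vgtD => //; apply: vgtMl.
  exists d; first by rewrite in_cons d_cs orbT.
  move=> q hq; apply: Hd; have [tc0 vtc] := vgt0_unit v_val htc htc0.
  move: hq; rewrite !vgeE // mulf_eq0 (negPf tc0) /=; case: eqVneq => //= Q0.
  by rewrite valM // vtc add0r.
exists c; first by rewrite mem_head.
move=> q; have [Q0 vQ] := vgt0_unit v_val hQ hQt.
rewrite !vgeE // mulf_eq0 (negPf Q0) orbF; case: eqVneq => //= tc0.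
by rewrite valM // vQ addr0.
Qed.

End FrobeniusLift.

(** * Unboundedness of the differents *)

(** An increase by eps can occur only finitely often: n is an index by which the largest possible
    number k of steps of size eps above [E 0] is reached. *)
Lemma nondecreasing_bounded_cauchy (E : nat -> rat) (B eps : rat) :
  (forall i j, (i <= j)%N -> E i <= E j) -> (forall i, E i <= B) -> 0 < eps ->
  exists n, forall i j, (n <= i)%N -> E j - E i < eps.
Proof.
move=> E_mono E_le eps0.
have [b Hb] := rat_bound ((B - E 0%N) / eps).
have P0 : exists k : nat, `[< exists n, E 0%N + k%:R * eps <= E n >].
  by exists 0%N; apply/asboolP; exists 0%N; rewrite mul0r addr0.
have Pb k : `[< exists n, E 0%N + k%:R * eps <= E n >] -> (k <= b)%N.
  move=> /asboolP [n Hn]; rewrite -(ler_nat rat) ltW //; apply: le_lt_trans Hb.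
  by rewrite ler_pdivlMr // lerBrDl (le_trans Hn).
have [k /asboolP [n Hn] kmax] := ex_maxnP P0 Pb.
exists n => i j ni; rewrite ltNge; apply/negP => le.
have : (k.+1 <= k)%N.
  apply: kmax; apply/asboolP; exists j; rewrite -natr1 mulrDl mul1r.
  by have := E_mono _ _ ni; lra.
by rewrite ltnn.
Qed.

Lemma rat_gt0_denq (x : rat) : 0 < x -> 1 <= `|denq x|%:R * x.
Proof.
move=> x0; rewrite mulrC -[`|denq x|%:R]/((`|denq x|%:Z)%:~R) absz_denq -numqE.
by rewrite -[1]/(1%:~R) ler_int -gtz0_ge1 numq_gt0.
Qed.

Lemma rat_lt1_denq (x : rat) : x < 1 -> `|denq x|%:R * x <= `|denq x|%:R - 1.
Proof.
move=> x1; have d0 : 0 < `|denq x|%:R :> rat by rewrite ltr0n absz_gt0 denq_neq0.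
have : `|denq x|%:R * x < `|denq x|%:R by rewrite gtr_pMr.
rewrite mulrC -[`|denq x|%:R]/((`|denq x|%:Z)%:~R) absz_denq -numqE.
by rewrite -[1]/(1%:~R) -rmorphB ltr_int ler_int; lia.
Qed.

Section Main.
Variables (p : nat) (K : fieldType) (Kbar : closedFieldType).
Variables (iota : {rmorphism K -> Kbar}) (v : Kbar -> \bar rat) (pi : K).
Hypothesis L : local_setting p iota v pi.
Local Notation ev := (ev iota).
Local Notation vge := (vge v).
Local Notation vgt := (vgt v).
Local Notation valq := (valq v).
Local Notation intp := (intp iota v).
Let v_val := ls_val L.

(** Here h may have coefficients with poles; [gam] is a lower bound for their valuations. *)
Lemma ev_lipschitz h : exists gam : rat, forall x y q, vge 0 x -> vge 0 y ->
  vge q (x - y) -> vge (q + gam) (ev h x - ev h y).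
Proof.
have [gam Hgam] := vge_lower_bound (size h) (fun i => iota h`_i) v_val.
exists gam => x y q hx hy hxy.
rewrite !(ev_coef iota _ (leqnn (size h))) -sumrB; apply: vge_sum => // i _.
rewrite -mulrBr addrC; apply: vgeM => //; first exact: Hgam.
rewrite subrXX; apply: vgeMr => //; apply: vge_sum => // j _.
by apply: vgeMl => //; apply: vgeX0.
Qed.

Variables (f : {poly K}) (t0 : K) (t : nat -> Kbar).
Hypotheses (f_monic : f \is monic) (f_size : (1 < size f)%N).
Hypotheses (f_int : intp f) (f_deriv : deriv_small iota v f).
Hypotheses (t0_int : vge 0 (iota t0)) (t_0 : t 0%N = iota t0).
Hypothesis t_S : forall n, ev f (t n.+1) = t n.

Lemma t_integral n : vge 0 (t n).
Proof.
elim: n => [|n IH]; first by rewrite t_0.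
by apply: (integral_preimage L f_monic) => //; rewrite t_S.
Qed.

Lemma t_equation n : exists h, [/\ h \is monic, intp h & ev h (t n) = 0].
Proof.
suff [h [h_monic hh _ h0]] : exists h, [/\ h \is monic, intp h, (1 < size h)%N & ev h (t n) = 0].
  by exists h.
elim: n => [|n [h [h_monic hh sh h0]]].
  exists ('X - t0%:P); split; rewrite ?monicXsubC ?size_XsubC //.
    by apply: (intpD L); [exact: (intpX L)|apply: (intpN L); exact: (intpC L)].
  by rewrite evB ev_polyX evC t_0 subrr.
exists (h \Po f); split.
- by rewrite monicE lead_coef_comp // (monicP h_monic) (monicP f_monic) expr1n mulr1.
- exact: (intp_comp L).
- have : (0 < (size (h \Po f)).-1)%N.
    by rewrite size_comp_poly muln_gt0 -!subn1 !subn_gt0 sh f_size.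
  by case: (size _).
- by rewrite ev_comp t_S.
Qed.

Lemma ev_fiter k n : ev (fiter f k) (t (n + k)) = t n.
Proof.
elim: k n => [|k IH] n; first by rewrite addn0 ev_polyX.
by rewrite ev_fiterS addnS t_S.
Qed.

Lemma fiter_preimage k x : vge 0 (ev (fiter f k) x) -> vge 0 x.
Proof.
elim: k x => [|k IH] x; first by rewrite ev_polyX.
by rewrite ev_fiterS => /IH; apply: (integral_preimage L f_monic).
Qed.

(* A point u of an unramified extension stays away from the conjugates t' of t_n0,
   since h0(u) has integral valuation and h0(t') has not. *)
Lemma unramified_far n0 M0 rs0 h0 : conjugates iota M0 rs0 -> t n0 \in rs0 ->
  ev h0 (t n0) != 0 -> (forall z : int, valq (ev h0 (t n0)) != z%:~R) ->
  exists A : rat, forall u q t', vge 0 u -> t' \in rs0 ->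
    (ev h0 u != 0 -> exists z : int, valq (ev h0 u) = z%:~R) ->
    vge q (u - t') -> q <= A.
Proof.
move=> C0 t_rs0 h00 ram; have [gam Hgam] := ev_lipschitz h0.
exists (valq (ev h0 (t n0)) - gam) => u q t' hu ht' unr hq.
have vt' : v (ev h0 t') = v (ev h0 (t n0)) by apply: (ls_conj L C0).
have t'_int : vge 0 t'.
  have := ls_conj L C0 'X ht' t_rs0; rewrite !ev_polyX => /eq_vge ->.
  exact: t_integral.
rewrite leNgt; apply/negP => lt.
have h0t'0 : ev h0 t' != 0.
  by apply: contra_neq h00 => /(conj_ev0 C0 ht' t_rs0).
have vt2 : valq (ev h0 t') = valq (ev h0 (t n0)) by apply: eq_valq vt'.
have : vgt (valq (ev h0 t')) (ev h0 u - ev h0 t').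
  by apply: vge_vgt (Hgam _ _ _ hu t'_int hq); rewrite vt2 -ltrBlDr.
move/(val_addl v_val h0t'0); rewrite subrK vt2 => -[/unr [z ez] e].
by have := ram z; rewrite -e ez eqxx.
Qed.

(** Roots of mu generate unramified extensions: reduced modulo mu, an element of K(c) has degree
    less than that of mu in c, so [res_free_int] applies. *)
Lemma res_minpoly_roots mu x : vge 0 x -> res_minpoly iota v mu x -> exists cs,
  [/\ map_poly iota mu = \prod_(c <- cs) ('X - c%:P), size cs = (size mu).-1 &
   forall c, c \in cs -> vge 0 c /\
     forall g, ev g c != 0 -> exists z : int, valq (ev g c) = z%:~R].
Proof.
move=> hx mu_min; have [mu_monic _ _ _] := mu_min.
have [cs Ecs] := closed_field_poly_normal (map_poly iota mu).
have {}Ecs : map_poly iota mu = \prod_(c <- cs) ('X - c%:P).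
  by rewrite {1}Ecs lead_coef_map (monicP mu_monic) rmorph1 scale1r.
exists cs; split=> // [|c hc].
  by rewrite -(size_map_poly iota) Ecs size_prod_XsubC.
have mu_c : ev mu c = 0 by apply/rootP; rewrite Ecs root_prod_XsubC.
have [c_int c_free] := res_minpoly_root L hx mu_min mu_c.
split=> // g; have -> : ev g c = ev (g %% mu) c.
  by rewrite {1}(divp_eq g mu) evD evM mu_c mulr0 add0r.
move=> g0; have gm0 : g %% mu != 0 by apply: contra_neq g0 => ->; rewrite ev0.
have [] := res_free_int L c_int c_free _ gm0 => //.
rewrite -ltnS prednK ?size_poly_gt0 ?monic_neq0 //.
by rewrite ltn_modp monic_neq0.
Qed.

Lemma fiter_monic k : fiter f k \is monic /\ (1 < size (fiter f k))%N.
Proof.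
elim: k => [|k [IH1 IH2]]; first by rewrite monicX size_polyX.
rewrite /fiter iterS -/(fiter f k); split.
  by rewrite monicE lead_coef_comp // (monicP IH1) (monicP f_monic) expr1n mulr1.
have : (0 < (size (fiter f k \Po f)).-1)%N.
  by rewrite size_comp_poly muln_gt0 -!subn1 !subn_gt0 IH2 f_size.
by case: (size _).
Qed.

Lemma conj_t_integral n M rs r : conjugates iota M rs -> t n \in rs -> r \in rs ->
  vge 0 r.
Proof.
move=> C t_rs hr; have := ls_conj L C 'X hr t_rs; rewrite !ev_polyX => /eq_vge ->.
exact: t_integral.
Qed.

Lemma sum_le_const (I : eqType) (s : seq I) (G : I -> rat) a :
  (forall i, i \in s -> G i <= a) -> \sum_(i <- s) G i <= (size s)%:R * a.
Proof.
elim: s => [|i s IH] H; first by rewrite big_nil mul0r.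
rewrite big_cons /= -natr1 mulrDl mul1r addrC lerD ?H ?mem_head ?IH // => j js.
by apply: H; rewrite in_cons js orbT.
Qed.

(* Both sides of D v(mu(t)) = sum_c v(M(c)) are the valuation of the resultant of
   M and mu; M divides M0 o f^k, whose value at c is bounded by unramified_far. *)
Lemma res_minpoly_bound n0 k M0 rs0 M rs mu cs A0 :
  conjugates iota M0 rs0 -> t n0 \in rs0 ->
  conjugates iota M rs -> t (n0 + k) \in rs ->
  map_poly iota mu = \prod_(c <- cs) ('X - c%:P) -> (forall c, c \in cs -> vge 0 c) ->
  (forall c q t', c \in cs -> t' \in rs0 ->
    vge q (ev (fiter f k) c - t') -> q <= A0) ->
  (size rs)%:R * valq (ev mu (t (n0 + k))) <= (size cs)%:R * ((size rs0)%:R * A0).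
Proof.
move=> C0 t_rs0 C t_rs Emu cs_int far; have [M_monic _ _ Mmin] := C.
pose Phi := M0 \Po fiter f k.
have [phi_monic phi_size] := fiter_monic k.
have Phi_monic : Phi \is monic.
  have [M0_monic _ _ _] := C0.
  by rewrite monicE lead_coef_comp // (monicP M0_monic) (monicP phi_monic) expr1n mulr1.
have /dvdpP [Q EQ] : M %| Phi.
  apply: (Mmin _ _ t_rs); rewrite ev_comp ev_fiter; apply/eqP.
  by rewrite -(conj_root C0).
have Q_monic : Q \is monic by rewrite -(monicMr Q M_monic) -EQ.
have [qs Eqs] := closed_field_poly_normal (map_poly iota Q).
have {}Eqs : map_poly iota Q = \prod_(q <- qs) ('X - q%:P).
  by rewrite {1}Eqs lead_coef_map (monicP Q_monic) rmorph1 scale1r.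
have qs_int q : q \in qs -> vge 0 q.
  rewrite -root_prod_XsubC -Eqs => /rootP q0; apply: (@fiter_preimage k).
  apply: (conj_t_integral C0 t_rs0); rewrite (conj_root C0) -ev_comp -/Phi EQ.
  by rewrite evM ev_horner q0 mul0r.
have Q_int c : c \in cs -> vge 0 (ev Q c).
  move=> hc; rewrite ev_horner Eqs horner_prod big_seq.
  elim/big_ind: _ => [|x y|q hq]; [exact: vge1|exact: vgeMl|].
  by rewrite hornerXsubC; apply: vgeB => //; [exact: cs_int|exact: qs_int].
(* Omitting the integral factor Q(c) only lowers the valuation, and Phi(c) has one factor for each
   conjugate of [t n0]; so the bound does not grow with k. *)
have M_bound c : c \in cs -> ev M c != 0 /\ valq (ev M c) <= (size rs0)%:R * A0.
  move=> hc.
  have far0 t' : t' \in rs0 -> ev (fiter f k) c - t' != 0.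
    move=> ht'; apply/eqP => e.
    by have := far c (A0 + 1) t' hc ht'; rewrite e vge0 // => /(_ isT); lra.
  have EPhi : ev Phi c = \prod_(t' <- rs0) (ev (fiter f k) c - t').
    by rewrite ev_comp (conj_evM C0).
  have Phi0 : ev Phi c != 0.
    by rewrite EPhi prodf_seq_neq0; apply/allP => t' ht' /=; apply: far0.
  have vPhi : valq (ev Phi c) <= (size rs0)%:R * A0.
    rewrite EPhi val_prod //; apply: sum_le_const => t' ht'.
    by apply: (far c _ t' hc ht'); apply: vge_val.
  move: (Phi0) vPhi; rewrite EQ evM mulf_eq0 negb_or => /andP [Q0 M00].
  rewrite valM // => vPhi; split=> //; apply: le_trans vPhi; rewrite lerDr.
  by have := Q_int c hc; rewrite vgeE // (negPf Q0).
have cr0 c r : c \in cs -> r \in rs -> c - r != 0.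
  move=> hc hr; have [] := M_bound c hc; rewrite (conj_evM C) prodf_seq_neq0.
  by move=> /allP /(_ r hr).
have Emu_r r : r \in rs -> valq (ev mu r) = \sum_(c <- cs) valq (c - r).
  move=> hr; rewrite ev_horner Emu horner_prod val_prod // => [|c hc].
    rewrite big_seq [RHS]big_seq; apply: eq_bigr => c hc.
    by rewrite hornerXsubC -opprB valN // cr0.
  by rewrite hornerXsubC -opprB oppr_eq0 cr0.
have -> : (size rs)%:R * valq (ev mu (t (n0 + k))) = \sum_(r <- rs) valq (ev mu r).
  rewrite big_seq (eq_bigr (fun=> valq (ev mu (t (n0 + k))))); last first.
    by move=> r hr; rewrite (eq_valq (ls_conj L C mu hr t_rs)).
  by rewrite -big_seq big_const_seq count_predT iter_addr_0 mulr_natl.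
rewrite big_seq (eq_bigr _ Emu_r) -big_seq exchange_big /=.
apply: sum_le_const => c hc; have [M00 ] := M_bound c hc.
rewrite (conj_evM C) val_prod // => r hr; exact: cr0.
Qed.

(* For x = t_n and g = mu, the value y = g(x) is almost the P-th power of some s(x);
   if it were less than 1 - eps, then s(x) would have valuation v(y) / P, too small
   for the denominators allowed in K(x). *)
Lemma val_ge1 M rs x g s (m a P : nat) (A : rat) :
  conjugates iota M rs -> x \in rs -> vge 0 x -> res_free iota v m x -> (0 < m)%N ->
  A < a%:R -> (0 < a)%N -> (a <= P)%N ->
  ev g x != 0 -> vgt 0 (ev g x) ->
  (size rs)%:R * valq (ev g x) <= m%:R * A ->
  vge (1 - (2 * a%:R)^-1) (ev g x - ev s x ^+ P) ->
  1 <= valq (ev g x).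
Proof.
move=> C x_rs hx x_free m0 Aa a0 aP y0 ypos ybound ys.
set y := ev g x in y0 ypos ybound ys *; set D : rat := (size rs)%:R in ybound *.
pose eps : rat := (2 * a%:R)^-1; rewrite -/eps in ys.
have a0' : 0 < a%:R :> rat by rewrite ltr0n.
have a1' : 1 <= a%:R :> rat by rewrite ler1n.
have m0' : 0 < m%:R :> rat by rewrite ltr0n.
have eps_a : eps * (2 * a%:R) = 1 by rewrite mulVf // mulf_neq0 ?gt_eqF.
have eps0 : 0 < eps by rewrite invr_gt0 mulr_gt0.
have eps1 : eps <= 2^-1 by nra.
have vy0 : 0 < valq y by move: ypos; rewrite vgtE // (negPf y0).
have D_denq h : ev h x != 0 -> (`|denq (valq (ev h x))|)%:R * m%:R <= D.
  move=> h0; rewrite -natrM ler_nat.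
  exact: (denq_bound L C x_rs hx x_free h0).
have y_large : 1 - eps <= valq y.
  rewrite leNgt; apply/negP => lt.
  have sP0 : ev s x ^+ P != 0 /\ valq (ev s x ^+ P) = valq y.
    have : vgt (valq y) (ev s x ^+ P - y).
      by apply: vge_vgt lt _; rewrite vgeBC.
    by move/(val_addl v_val y0); rewrite subrK.
  have [sP00 vsP] := sP0.
  have P0 : (0 < P)%N by apply: leq_trans aP.
  have s0 : ev s x != 0 by move: sP00; rewrite expf_eq0 P0.
  rewrite valX // in vsP.
  have P0' : 0 < P%:R :> rat by rewrite ltr0n.
  have vs0 : 0 < valq (ev s x) by rewrite -(pmulr_rgt0 _ P0') vsP.
  have h1 := rat_gt0_denq vs0; have h2 := D_denq s s0.
  have h3 : m%:R <= D * valq (ev s x).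
    apply: le_trans (ler_wpM2r (ltW vs0) h2).
    by rewrite mulrAC ler_pMl.
  have h4 : P%:R * m%:R <= m%:R * A.
    apply: le_trans ybound; rewrite -vsP mulrCA; exact: ler_wpM2l.
  have h5 : P%:R <= A by rewrite mulrC ler_pM2l in h4.
  have : a%:R <= P%:R :> rat by rewrite ler_nat.
  by move=> h6; have := lt_le_trans Aa (le_trans h6 h5); rewrite ltxx.
(* Let e be the denominator of v(y). If 1 - eps <= v(y) < 1, then 1/e <= eps, so e >= 2a; as v(y) >=
   1/2, this gives e v(y) >= a > A, against [h3]. *)
rewrite leNgt; apply/negP => lt.
have h1 := rat_lt1_denq lt; have h2 := D_denq g y0; rewrite -/y in h2.
set e : rat := (`|denq (valq y)|)%:R in h1 h2.
have e0 : 0 < e by rewrite ltr0n absz_gt0 denq_neq0.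
have h3 : e * valq y <= A.
  rewrite -(ler_pM2l m0'); apply: le_trans ybound.
  by rewrite mulrA [m%:R * e]mulrC ler_wpM2r // ltW.
nra.
Qed.

Theorem different_unbounded n0 h0 : ev h0 (t n0) != 0 ->
  (forall z : int, valq (ev h0 (t n0)) != z%:~R) ->
  forall B : rat, exists N E, is_val_different iota v (adjoin iota (t N)) E /\ B < E.
Proof.
move=> h00 ram B; apply: contrapT => H.
have /choice [M /choice [rs HM]] : forall n, exists M rs, conjugates iota M rs /\ t n \in rs.
  by move=> n; exact: conjugates_ex (ls_closure L) (ls_char0 L) (t n).
have C n := (HM n).1; have t_rs n := (HM n).2; have t_int := t_integral.
have /choice [E HE] : forall n, exists E, diff_val iota v (rs n) (t n) E.
  by move=> n; have := diff_val_ex L (C n) (t_rs n) (t_int n).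
have E_le n : E n <= B.
  rewrite leNgt; apply/negP => lt; apply: H; exists n, (E n); split=> //.
  by have := diff_valE L (C n) (t_rs n) (HE n).
have E_mono i j : (i <= j)%N -> E i <= E j.
  move=> ij; apply: (diff_val_le L (C j) (t_rs j) (C i) (t_rs i) _ (HE j) (HE i)).
  by rewrite -[X in t X](subnKC ij); exact: ev_fiter.
have [A0 HA0] := unramified_far (C n0) (t_rs n0) h00 ram.
pose A := (size (rs n0))%:R * A0.
(* The exponent P = p^a exceeds A because a <= p^a. The successor makes a positive whatever the sign
   of A. *)
have [a' Ha'] := rat_bound A; pose a := a'.+1.
have Aa : A < a%:R by apply: lt_trans Ha' _; rewrite ltr_nat.
have p1 := prime_gt1 (ls_prime L).
have aP : (a <= p ^ a)%N by apply/ltnW/ltn_expl.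
have P0 : 0 < (p ^ a)%:R :> rat by rewrite ltr0n; apply: leq_trans aP.
pose eps : rat := (2 * a%:R)^-1.
have eps0 : 0 < eps by rewrite invr_gt0 mulr_gt0 ?ltr0n.
have [n1 Hn1] := nondecreasing_bounded_cauchy E_mono E_le (divr_gt0 eps0 P0).
(* [n1] makes the differents nearly constant from level n on; [k1] makes k applications of f push
   v(t_n - c) >= 1 past the bound [A0]. *)
have [k1 Hk1] := rat_bound A0; pose k := (n1 + k1)%N; pose n := (n0 + k)%N.
have [h [h_monic h_int ht]] := t_equation n.
have [|mu mu_min] := res_minpoly_ex h_monic h_int (t := t n).
  by rewrite ht vgt0.
have [mu_monic mu_int mut mu_free] := mu_min.
have [cs [Emu scs Hcs]] := res_minpoly_roots (t_int n) mu_min.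
have far c q t' : c \in cs -> t' \in rs n0 ->
    vge q (ev (fiter f k) c - t') -> q <= A0.
  move=> hc ht'; have [c_int c_unr] := Hcs c hc.
  apply: HA0 => //; first by apply: (intp_ev L) => //; apply: (intp_fiter L).
  by rewrite -ev_comp; apply: c_unr.
have bound := res_minpoly_bound (C n0) (t_rs n0) (C n) (t_rs n) Emu
  (fun c hc => (Hcs c hc).1) far.
rewrite -/n -/A scs in bound.
have [c hc near] : exists2 c, c \in cs & vge 1 (t n - c).
  have [|_ _ nr] := near_root L (t_int n) (cs := cs).
    by move=> c /Hcs [].
  have [|c hc Hc] := nr.
    by rewrite -Emu deriv_map; apply: (res_minpoly_separable L (t_int n) mu_min).
  exists c => //; apply: Hc; rewrite -Emu -[_.[_]]/(ev mu (t n)).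
  rewrite vgeE //; case: eqVneq => //= mut0.
  (* The congruence holds at every integral point, hence at all conjugates of t_(n+a), as the
     relative trace requires. *)
  have [b [b_int Hb]] := frobenius_iter L a f_int f_deriv mu_int.
  have phi_t := ev_fiter a n.
  have [||r hr|s Hs] := frobenius_descent L (C (n + a)%N) (t_rs _) (C n) (t_rs n)
    (t_int n) phi_t (HE _) (HE n) (u := mu) (b := b) (k := a).
  - exact: (intp_ev L).
  - exact: (intp_ev L).
  - by apply: Hb; apply: (conj_t_integral (C (n + a)%N)).
  apply: (val_ge1 (C n) (t_rs n) (t_int n) mu_free _ Aa _ aP mut0 mut bound (s := s)) => //.
    rewrite -ltnS prednK ?size_poly_gt0 ?monic_neq0 //.
    rewrite ltnNge; apply/negP => /size1_polyC muC; move: mu_monic mut.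
    by rewrite muC monicE lead_coefC => /eqP ->; rewrite ev1 vgt1F.
  apply: vge_le Hs; rewrite lerD2l lerN2 -/eps.
  have n1n : (n1 <= n)%N by rewrite /n /k addnCA leq_addr.
  by have := Hn1 n (n + a)%N n1n; rewrite ltr_pdivlMr // mulrC => /ltW.
have [c_int _] := Hcs c hc.
have := contraction_iter L k f_int f_deriv (t_int n) c_int near.
rewrite ev_fiter vgeBC // => /(far c _ _ hc (t_rs n0)) kA.
have : k1%:R <= k.+1%:R :> rat by rewrite ler_nat leqW // leq_addl.
by move=> h1; have := lt_le_trans Hk1 (le_trans h1 kA); rewrite ltxx.
Qed.

End Main.

(** * Finite extensions of the field of p-adic numbers *)

Lemma valq_exprz (K Kbar : fieldType) (iota : {rmorphism K -> Kbar})
    (v : Kbar -> \bar rat) (pi : K) (z : int) : is_valuation v ->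
  pi != 0 -> valq v (iota pi) = 1 -> valq v (iota (pi ^ z)) = z%:~R.
Proof.
move=> v_val pi0 vpi; have ipi0 : iota pi != 0 by rewrite fmorph_eq0.
case: z => n; first by rewrite -exprnP rmorphXn valX // vpi mulr1.
by rewrite NegzE -exprnN fmorphV rmorphXn valV ?expf_neq0 // valX // vpi mulr1 rmorphN.
Qed.

Section PadicExtension.
Variables (p : nat) (p_prime : prime p).
Variables (Qp : fieldType) (vp : Qp -> \bar rat) (Qp_padic : is_padic_field p vp).
Variables (K : fieldExtType Qp) (Kbar : closedFieldType) (iota : {rmorphism K -> Kbar}).
Variables (v : Kbar -> \bar rat) (v_norm : is_normalized_valuation vp iota v).

Let v_val : is_valuation v := let: And3 H _ _ := v_norm in H.
Let vp_val : is_valuation vp := let: And4 H _ _ _ := Qp_padic in H.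
Let j : {rmorphism Qp -> Kbar} := iota \o in_alg K.

Lemma padic_natr_neq0 n : (n.+1)%:R != 0 :> Qp.
Proof.
have [_ H _ _] := Qp_padic; apply/eqP => n0.
have := H n.+1%:R; rewrite ratr_nat n0 v0 // /padic_val pnatr_eq0 /=.
by [].
Qed.

Lemma ext_natr_neq0 n : (n.+1)%:R != 0 :> K.
Proof. by rewrite -scaler_nat scaler_eq0 negb_or padic_natr_neq0 oner_neq0. Qed.

Lemma val_scale : exists2 e : rat, 0 < e & forall a, a != 0 -> valq v (j a) = e * valq vp a.
Proof.
have [_ [e e0 He] _] := v_norm; exists e => // a a0.
have ja0 : j a != 0 by rewrite fmorph_eq0.
apply/EFin_inj; rewrite EFinM -(v_fin v_val ja0) -(v_fin vp_val a0).
exact: He.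
Qed.

Lemma vgt_scale : exists2 e : rat, 0 < e & forall a q, vgt v (e * q) (j a) = vgt vp q a.
Proof.
have [e e0 He] := val_scale; exists e => // a q.
rewrite !vgtE // fmorph_eq0; case: eqVneq => //= a0.
by rewrite He // ltr_pM2l.
Qed.

Lemma vge0_scale a : vge v 0 (j a) = vge vp 0 a.
Proof.
have [e e0 He] := val_scale.
rewrite !vgeE // fmorph_eq0; case: eqVneq => //= a0.
by rewrite He // pmulr_rge0.
Qed.

Lemma vgt0_scale a : vgt v 0 (j a) = vgt vp 0 a.
Proof. by have [e e0 He] := vgt_scale; rewrite -(He a 0) mulr0. Qed.

Lemma Qp_complete u : val_cauchy (v \o j) u -> exists l, val_converges (v \o j) u l.
Proof.
have [_ _ _ compl] := Qp_padic; have [e e0 He] := vgt_scale => cu.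
have [|l Hl] := compl u.
  move=> B; have [N HN] := cu (e * B); exists N => i k hi hk.
  by have := HN i k hi hk; rewrite -[X in is_true X]/(vgt v (e * B) (j (u i - u k))) He.
exists l => B; have [N HN] := Hl (B / e); exists N => i hi.
rewrite -[X in is_true X]/(vgt v B (j (u i - l))).
have -> : B = e * (B / e) by rewrite mulrC divfK // gt_eqF.
by rewrite He; exact: HN.
Qed.

(** By [norm_equiv] a Cauchy sequence in K is Cauchy in each coordinate with respect to a basis over
    Qp. *)
Lemma K_complete u : val_cauchy (v \o iota) u -> exists l, val_converges (v \o iota) u l.
Proof.
move=> cu; pose b := vbasis {:K}; pose n := \dim {:K}.
pose w i := iota b`_i.
(* Coordinates are extended by 0 to all natural indices, the form in which [norm_equiv] takes
   them. *)
pose a (x : K) i : Qp := if insub i is Some i' then coord b (i' : 'I_n) x else 0.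
have aE x : iota x = \sum_(i < n) j (a x i) * w i.
  rewrite {1}(coord_vbasis (memvf x)) rmorph_sum; apply: eq_bigr => i _.
  by rewrite /a valK /w /j /= -rmorphM mulr_algl.
have [C HC] : exists C : rat, forall (a : nat -> Qp) q,
    vge v q (\sum_(i < n) j (a i) * w i) ->
    forall i, (i < n)%N -> vge v (q - C) (j (a i)).
  apply: (norm_equiv v_val Qp_complete) => c S i hi.
  have /freeP fr : free b := basis_free (vbasisP _).
  apply: (fr (fun i => c i) _ (Ordinal hi)); apply: (fmorph_inj iota).
  rewrite rmorph0 -[RHS]S rmorph_sum; apply: eq_bigr => k _.
  by rewrite /w /j /= -rmorphM mulr_algl.
have aB x y i : a (x - y) i = a x i - a y i.
  by rewrite /a; case: insubP => [i' _ _|_]; rewrite ?linearB ?subrr.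
have /choice [l Hl] : forall i, exists l : Qp,
    (i < n)%N -> val_converges (v \o j) (fun k => a (u k) i) l.
  move=> i; case: (ltnP i n) => [ilt|_]; last by exists 0.
  suff : val_cauchy (v \o j) (fun k => a (u k) i).
    by move=> /Qp_complete [l Hl]; exists l.
  move=> B; have [N HN] := cu (B + C); exists N => k1 k2 h1 h2.
  have := HN k1 k2 h1 h2; rewrite /comp -aB.
  rewrite -[X in is_true X -> _]/(vgt v (B + C) (iota (u k1 - u k2))).
  rewrite -[X in _ -> is_true X]/(vgt v B (j (a (u k1 - u k2) i))).
  have [d0|d0] := eqVneq (iota (u k1 - u k2)) 0.
    move=> _; move/eqP: d0; rewrite fmorph_eq0 => /eqP ->.
    by rewrite -(subrr (u k1)) aB subrr rmorph0 vgt0.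
  rewrite vgtE // (negPf d0) /= => h.
  have h2' : vge v (valq v (iota (u k1 - u k2))) (\sum_(i < n) j (a (u k1 - u k2) i) * w i).
    by rewrite -aE vge_val.
  by apply: vge_vgt (HC _ _ h2' i ilt); rewrite ltrBrDr.
exists (\sum_(i < n) l i *: b`_i) => B.
have [N HN] : exists N : nat, forall (i : 'I_n) k, (N <= k)%N ->
    vgt v B (j (a (u k) i - l i) * w i).
  have /choice [N HN] : forall i : 'I_n, exists N : nat, forall k, (N <= k)%N ->
      vgt v B (j (a (u k) i - l i) * w i).
    move=> i; have [N HN] := Hl i (ltn_ord i) (B - valq v (w i)).
    exists N => k /HN; rewrite -[X in is_true X -> _]/(vgt v _ (j (a (u k) i - l i))).
    have [w0|w0] := eqVneq (w i) 0; first by rewrite w0 mulr0 vgt0.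
    rewrite !vgtE // mulf_eq0 (negPf w0) orbF; case: eqVneq => //= d0.
    by rewrite valM // ltrBlDr.
  exists (\max_(i < n) N i) => i k hk; apply: HN.
  by apply: leq_trans hk; apply: leq_bigmax.
exists N => k hk; rewrite -[X in is_true X]/(vgt v B (iota (u k - \sum_(i < n) l i *: b`_i))).
have -> : iota (u k - \sum_(i < n) l i *: b`_i) = \sum_(i < n) j (a (u k) i - l i) * w i.
  rewrite rmorphB aE rmorph_sum -sumrB; apply: eq_bigr => i _.
  rewrite rmorphB mulrBl; congr (_ - _).
  by rewrite /w /j /= -rmorphM mulr_algl.
by apply: vgt_sum => // i _; apply: HN.
Qed.

Lemma uniformizer : exists pi : K, [/\ pi != 0, valq v (iota pi) = 1 &
  forall a : K, vgt v 0 (iota a) -> vge v 1 (iota a)].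
Proof.
have [_ _ [pi gen vpi]] := v_norm; exists pi.
have pi0 : pi != 0 by apply: contra_eq_neq vpi => ->; rewrite rmorph0 v0.
have vpi1 : valq v (iota pi) = 1 by rewrite /valq vpi.
split=> // a ha; have : maximal_ideal (v \o iota) a := ha.
rewrite gen => -[y hy <-]; rewrite rmorphM -vpi1.
by apply: vgeMr => //; apply: vge_val.
Qed.

(** Divided by the power of pi with exponent floor(v(a)), [a] gets a valuation in [0, 1), and
    positive valuations on K are at least 1. *)
Lemma val_int (a : K) : a != 0 -> exists z : int, valq v (iota a) = z%:~R.
Proof.
have [pi [pi0 vpi Hpi]] := uniformizer => a0.
pose z := Num.floor (valq v (iota a)); exists z.
have /andP [h1 h2] := floor_itv (valq v (iota a)); rewrite -/z rmorphD in h1 h2.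
have vz : valq v (iota (a * pi ^ (- z))) = valq v (iota a) - z%:~R.
  by rewrite rmorphM valM ?fmorph_eq0 ?expfz_neq0 // valq_exprz // rmorphN.
have b0 : iota (a * pi ^ (- z)) != 0 by rewrite fmorph_eq0 mulf_neq0 ?expfz_neq0.
apply/eqP; rewrite eq_le h1 andbT leNgt; apply/negP => lt.
have := Hpi (a * pi ^ (- z)); rewrite vgtE // vgeE // (negPf b0) /= vz.
by rewrite subr_gt0 lt => /(_ isT) h3; move: h2 h3; rewrite /=; lra.
Qed.

Lemma val_p : vge v 1 (p%:R : Kbar).
Proof.
have [pi [_ _ Hpi]] := uniformizer.
have -> : p%:R = iota (p%:R)%:A :> Kbar by rewrite scaler_nat !rmorph_nat.
apply: Hpi; rewrite -[iota _]/(j p%:R) vgt0_scale /vgt -(ratr_nat Qp).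
have [_ -> _ _] := Qp_padic; have p0 := prime_gt0 p_prime.
rewrite /padic_val pnatr_eq0 gtn_eqF // (numq_int p) (denq_int p) /= lognE p_prime p0 dvdnn.
by rewrite divnn p0 logn1.
Qed.

Lemma freshman_vgt x y : vge v 0 x -> vge v 0 y ->
  vgt v 0 ((x + y) ^+ p - (x ^+ p + y ^+ p)).
Proof.
move=> hx hy; have := freshman2 v_val p_prime val_p hx hy.
by rewrite mulr0 addr0; apply: vge_vgt.
Qed.

(** The integral elements whose residue class lies in the prime field with p elements. *)
Definition frob_fixed (x : Kbar) : Prop := vge v 0 x /\ vgt v 0 (x ^+ p - x).

Lemma frob_fixedB x y : frob_fixed x -> frob_fixed y -> frob_fixed (x - y).
Proof.
move=> [hx fx] [hy fy]; split; first exact: vgeB.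
have hxy : vge v 0 (x - y) by apply: vgeB.
have := freshman_vgt hxy hy; rewrite subrK => h.
have -> : (x - y) ^+ p - (x - y) =
  (x ^+ p - x) - (y ^+ p - y) - (x ^+ p - ((x - y) ^+ p + y ^+ p)) by ring.
by apply: vgtB => //; apply: vgtB.
Qed.

Lemma frob_fixedN x : frob_fixed x -> frob_fixed (- x).
Proof.
move=> hx; rewrite -sub0r; apply: frob_fixedB => //; split; first exact: vge0.
by rewrite expr0n gtn_eqF ?prime_gt0 // subrr vgt0.
Qed.

Lemma frob_fixed_near x y : frob_fixed x -> vgt v 0 y -> frob_fixed (x + y).
Proof.
move=> [hx fx] hy; split; first by apply: vgeD => //; apply: vgtW.
have -> : (x + y) ^+ p - (x + y) =
  ((x + y) ^+ p - (x ^+ p + y ^+ p)) + (x ^+ p - x) + (y ^+ p - y) by ring.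
apply: vgtD => //; first by apply: vgtD => //; apply: freshman_vgt => //; apply: vgtW.
apply: vgtB => //; rewrite -(prednK (prime_gt0 p_prime)) exprSr; apply: vgtMl => //.
by apply: vgeX0 => //; apply: vgtW.
Qed.

Lemma frob_fixed_nat n : frob_fixed n%:R.
Proof.
split; first exact: vge_natr.
have le : (n <= n ^ p)%N.
  by case: (n) => // k; rewrite -{1}(expn1 k.+1) leq_pexp2l // prime_gt0.
have := fermat_little n p_prime => /eqP; rewrite eqn_mod_dvd // => /dvdnP [k E].
rewrite -natrX -natrB // E natrM; apply: vgtMl => //; first exact: vge_natr.
exact: vge_vgt val_p.
Qed.

Lemma frob_fixed_int (z : int) : frob_fixed z%:~R.
Proof.
case: z => n; first exact: frob_fixed_nat.
by rewrite NegzE rmorphN; apply/frob_fixedN/frob_fixed_nat.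
Qed.

Lemma frob_fixed_div x y : frob_fixed x -> frob_fixed y -> y != 0 -> valq v y = 0 ->
  frob_fixed (x / y).
Proof.
move=> [hx fx] [hy fy] y0 vy.
have hyV : vge v 0 y^-1 by rewrite vgeE // valV // vy oppr0 lexx orbT.
split; first exact: vgeMr.
have yp0 : y ^+ p != 0 by rewrite expf_neq0.
have -> : (x / y) ^+ p - x / y =
    ((y^-1) ^+ p * y^-1) * (y * (x ^+ p - x) - x * (y ^+ p - y)).
  rewrite exprMn exprVn; field.
  by rewrite y0 yp0.
apply: vgtMl => //; first by apply: vgeMl => //; apply: vgeX0.
by apply: vgtB => //; apply: vgtMl.
Qed.

(* Fermat's little theorem in Z_p, by density of the rational numbers. *)
Lemma frob_fixed_padic a : vge v 0 (j a) -> frob_fixed (j a).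
Proof.
rewrite vge0_scale => ha; have [_ padic dense _] := Qp_padic.
have [q Hq] := dense a 0; rewrite -/(vgt vp 0 _) in Hq.
have -> : j a = j (ratr q) + j (a - ratr q) by rewrite rmorphB addrC subrK.
apply: frob_fixed_near; last by rewrite vgt0_scale.
have q_int : vge vp 0 (ratr q).
  by rewrite -(subKr a (ratr q)); apply: vgeB => //; apply: vgtW.
have -> : j (ratr q) = (numq q)%:~R / (denq q)%:~R.
  by rewrite /ratr fmorph_div !rmorph_int.
have dE : (denq q)%:~R = (`|denq q|)%:R :> Qp by rewrite -[RHS]/((`|denq q|%:Z)%:~R) absz_denq.
have d0 : (0 < `|denq q|)%N by rewrite absz_gt0 denq_neq0.
have dp0 : (denq q)%:~R != 0 :> Qp by rewrite dE -(prednK d0) padic_natr_neq0.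
(* q is p-integral and in lowest terms, so p does not divide its denominator, which is therefore a
   unit. *)
have log0 : logn p `|denq q| = 0%N.
  have [->|q0] := eqVneq q 0; first by rewrite (denq_int 0) logn1.
  apply/eqP; apply: contraT; rewrite -lt0n logn_gt0 mem_primes p_prime d0 /= => pd.
  have pn : logn p `|numq q| = 0%N.
    apply/eqP; rewrite eqn0Ngt logn_gt0 mem_primes p_prime /= negb_and orbC.
    apply/orP; left; apply/negP => pn.
    have := coprime_num_den q => /(coprime_dvdl pn) /(coprime_dvdr pd).
    by rewrite /coprime gcdnn gtn_eqF // prime_gt1.
  move: q_int; rewrite /vge padic /padic_val (negPf q0) pn sub0r lee_fin oppr_ge0 lern0.
  by rewrite eqn0Ngt logn_gt0 mem_primes p_prime d0 pd.
have vd : valq v ((denq q)%:~R : Kbar) = 0.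
  have [e e0 He] := val_scale.
  have -> : (denq q)%:~R = j (denq q)%:~R by rewrite rmorph_int.
  rewrite He //; have := padic (denq q)%:~R; rewrite ratr_int /valq => ->.
  rewrite /padic_val intr_eq0 (negPf (denq_neq0 q)) numq_int denq_int log0 logn1.
  by rewrite subrr mulr0.
apply: frob_fixed_div => //; [exact: frob_fixed_int|exact: frob_fixed_int|].
have -> : (denq q)%:~R = j (denq q)%:~R by rewrite rmorph_int.
by rewrite fmorph_eq0.
Qed.

(* The relation is additive in the powers x ^ (p ^ i): as long as its first
   coefficient vanishes modulo p, take a p-th root of it; then solve for x. *)
Lemma perfect_relation (x : K) : vge v 0 (iota x) -> forall n (a : nat -> Qp),
  (forall i, vge v 0 (j (a i))) -> (exists2 i, (i <= n)%N & ~~ vgt v 0 (j (a i))) ->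
  vgt v 0 (\sum_(i < n.+1) j (a i) * iota x ^+ (p ^ i)) ->
  exists y : K, vge v 0 (iota y) /\ vgt v 0 (iota (x - y ^+ p)).
Proof.
move=> hx; set X := iota x in hx *; elim=> [|n IH] a ha [i0 i0n hi0] S.
  move: i0n hi0; rewrite leqn0 => /eqP -> ha0; move: S; rewrite big_ord1 expn0 expr1.
  case/vgtM0 => // [h|hX]; first by rewrite h in ha0.
  exists 0; rewrite rmorph0 vge0 // expr0n gtn_eqF ?prime_gt0 // subr0.
  by [].
have p0 := prime_gt0 p_prime.
(* The coefficients are fixed by Frobenius modulo the maximal ideal, so shifting all exponents from
   p^i to p^(i+1) amounts to raising the sum to the p-th power. *)
have hterm (c : nat -> Qp) : (forall i, vge v 0 (j (c i))) ->
    vgt v 0 (\sum_(i < n.+1) j (c i) * X ^+ (p ^ i.+1) -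
             (\sum_(i < n.+1) j (c i) * X ^+ (p ^ i)) ^+ p).
  move=> hc.
  pose T := \sum_(i < n.+1) (j (c i) * X ^+ (p ^ i)) ^+ p.
  have -> : forall A B : Kbar, A - B = (A - T) + (T - B) by move=> A B; ring.
  apply: vgtD => //.
    rewrite -sumrB; apply: vgt_sum => // i _.
    rewrite exprMn -exprM -expnSr -mulrBl mulrC; apply: vgtMl => //; first exact: vgeX0.
    by rewrite -opprB vgtN //; case: (frob_fixed_padic (hc i)).
  rewrite -opprB vgtN //.
  have := @freshman1 _ v v_val p p_prime val_p _ (index_enum 'I_n.+1)
    (fun i : 'I_n.+1 => j (c i) * X ^+ (p ^ i)) 0.
  rewrite mulr0 addr0 => H; apply: vge_vgt (H _) => // i _.
  by apply: vgeMl => //; apply: vgeX0.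
move: S; rewrite big_ord_recl /= expn0 expr1.
under eq_bigr do rewrite /bump /= add1n.
case: (boolP (vgt v 0 (j (a 0%N)))) => ha0 S.
  apply: (IH (fun i => a i.+1)) => //.
    by case: i0 i0n hi0 => [|i] hi hai; [rewrite ha0 in hai|exists i].
  have hT := hterm (fun i => a i.+1) (fun i => ha i.+1).
  apply: (vgtX0 v_val _ (n := p)).
    by apply: vge_sum => // i _; apply: vgeMl => //; apply: vgeX0.
  set A := (X in X ^+ p) in hT *; set B := \sum_(i < n.+1) _ in S hT.
  have -> : A ^+ p = (j (a 0%N) * X + B) - j (a 0%N) * X - (B - A ^+ p) by ring.
  apply: vgtB => //; apply: vgtB => //; rewrite mulrC; exact: vgtMl.
have [ja0 va0] := vgt0_unit v_val (ha 0%N) ha0.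
have a0 : a 0%N != 0 by move: ja0; rewrite fmorph_eq0.
(* Solved for x, the relation reads x = sum of c_i x^(p^(i+1)) up to a small error, and the right
   side is nearly the p-th power of the sum of the c_i x^(p^i). *)
pose c i := - (a i.+1 / a 0%N).
have hV : vge v 0 (j (a 0%N))^-1 by rewrite vgeE // valV // va0 oppr0 lexx orbT.
have hc i : vge v 0 (j (c i)).
  by rewrite rmorphN fmorph_div vgeN //; apply: vgeMr.
exists (\sum_(i < n.+1) (c i)%:A * x ^+ (p ^ i)).
have Ey : iota (\sum_(i < n.+1) (c i)%:A * x ^+ (p ^ i)) =
    \sum_(i < n.+1) j (c i) * X ^+ (p ^ i).
  by rewrite rmorph_sum; apply: eq_bigr => i _; rewrite rmorphM rmorphXn.
split; first by rewrite Ey; apply: vge_sum => // i _; apply: vgeMl => //; apply: vgeX0.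
rewrite rmorphB rmorphXn Ey -/X.
have hT := hterm c hc; set A := (X in X ^+ p) in hT *.
have -> : X - A ^+ p = (j (a 0%N))^-1 *
   (j (a 0%N) * X + \sum_(i < n.+1) j (a i.+1) * X ^+ (p ^ i.+1)) + (\sum_(i < n.+1) j (c i) * X ^+ (p ^ i.+1) - A ^+ p).
  have -> : \sum_(i < n.+1) j (c i) * X ^+ (p ^ i.+1) =
     - ((j (a 0%N))^-1 * \sum_(i < n.+1) j (a i.+1) * X ^+ (p ^ i.+1)).
    rewrite mulr_sumr -sumrN; apply: eq_bigr => i _.
    have -> : j (c i) = - ((j (a 0%N))^-1 * j (a i.+1)).
      by rewrite /c rmorphN fmorph_div mulrC.
    by rewrite mulNr mulrA.
  by rewrite mulrDr mulKf //; ring.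
by apply: vgtD => //; apply: vgtMl.
Qed.

(** More powers x^(p^i) than the degree of K over Qp are linearly dependent. Dividing the relation
    by its coefficient of least valuation makes the coefficients integral, one of them a unit, as
    [perfect_relation] demands. *)
Lemma perfect_residue (x : K) : vge v 0 (iota x) ->
  exists y : K, vge v 0 (iota y) /\ vge v 1 (iota (x - y ^+ p)).
Proof.
have [pi [_ _ Hpi]] := uniformizer.
move=> hx; suff [y [hy hxy]] : exists y, vge v 0 (iota y) /\ vgt v 0 (iota (x - y ^+ p)).
  by exists y; split=> //; apply: Hpi.
pose n := \dim {:K}.
pose X := [tuple x ^+ (p ^ i) | i < n.+1].
have nfree : ~~ free X.
  apply/negP => /eqP; rewrite size_tuple => dX.
  by have := dimvS (subvf <<X>>); rewrite dX ltnn.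
have [k kS [i0 ki0]] : exists2 k : 'I_n.+1 -> Qp, \sum_(i < n.+1) k i *: X`_i = 0 &
    exists i, k i != 0.
  apply: contrapT => H; move/negP: nfree; apply; apply/freeP => k kS i.
  by apply/eqP; apply: contraT => ki; exfalso; apply: H; exists k => //; exists i.
have [m km0 kmin] := @arg_minP _ _ _ i0 (fun i => k i != 0) (fun i => valq vp (k i)) ki0.
pose a i : Qp := if insub i is Some i' then k (i' : 'I_n.+1) / k m else 0.
have aE (i : 'I_n.+1) : a i = k i / k m by rewrite /a valK.
apply: (perfect_relation hx (n := n) (a := a)).
- move=> i; rewrite vge0_scale /a; case: insubP => [i' _ _|_]; last exact: vge0.
  rewrite vgeE // mulf_eq0 invr_eq0 (negPf km0) orbF; case: eqVneq => //= ki'.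
  by rewrite val_div // subr_ge0 kmin.
- exists m; first by rewrite -ltnS.
  by rewrite aE mulfV // rmorph1 vgt1F.
- rewrite (_ : \sum_(i < _) _ = 0) ?vgt0 //.
  have := congr1 (fun z => iota ((k m)^-1 *: z)) kS; rewrite scaler0 rmorph0 => E.
  rewrite -[RHS]E scaler_sumr rmorph_sum; apply: eq_bigr => i _.
  rewrite aE scalerA (_ : X`_i = x ^+ (p ^ i)).
    by rewrite [k i / _]mulrC -mulr_algl [RHS]rmorphM rmorphXn.
  by rewrite -tnth_nth tnth_mktuple.
Qed.

Lemma padic_local_setting : is_algebraic_closure iota ->
  exists pi, local_setting p iota v pi.
Proof.
move=> closure; have [pi [pi0 vpi _]] := uniformizer; exists pi; split=> //.
- exact: ext_natr_neq0.
- by move=> M rs C h r r'; apply: (conj_val v_val K_complete C).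
- exact: val_int.
- exact: val_p.
- exact: perfect_residue.
Qed.

End PadicExtension.

Theorem proposition4p3 (p : nat) (p_prime : prime p)
  (Qp : fieldType) (vp : Qp -> \bar rat) (Qp_padic : is_padic_field p vp)
  (K : fieldExtType Qp)
  (Kbar : closedFieldType) (iota : {rmorphism K -> Kbar})
  (Kbar_closure : is_algebraic_closure iota)
  (vK : Kbar -> \bar rat) (vK_norm : is_normalized_valuation vp iota vK)
  (d : nat) (d_ge2 : (2 <= d)%N)
  (f : {poly K}) (f_monic : f \is monic) (f_deg : size f = d.+1)
  (f_int : coefs_in (ring_of_integers (vK \o iota)) f)
  (f_deriv : coefs_in (maximal_ideal (vK \o iota)) f^`())
  (t0 : K) (t0_int : ring_of_integers (vK \o iota) t0)
  (t : nat -> Kbar) (t_0 : t 0%N = iota t0)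
  (t_S : forall n : nat, (map_poly iota f).[t n.+1] = t n)
  (Kinf_ram : ~ unramified iota vK (\bigcup_n adjoin iota (t n))) :
  forall B : rat, exists N : nat, exists r : rat,
    is_val_different iota vK (adjoin iota (t N)) r /\ B < r.
Proof.
have [pi L] := padic_local_setting p_prime Qp_padic vK_norm Kbar_closure.
have [n0 [h0 [h00 ram]]] : exists n0 h0, ev iota h0 (t n0) != 0 /\
    forall z : int, valq vK (ev iota h0 (t n0)) != z%:~R.
  (* An element of integral valuation z has the valuation of [pi ^ z], so if all valuations were
     integral, every finite subextension would be unramified. *)
  apply: contrapT => H; apply: Kinf_ram => F sub x x0.
  have [n0 _] : (\bigcup_n adjoin iota (t n)) (subext_emb F x) by apply: sub; exists x.
  have [M [rs [C t_rs]]] := conjugates_ex (ls_closure L) (ls_char0 L) (t n0).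
  rewrite (adjoinE C t_rs) => -[h0 hx].
  have h00 : ev iota h0 (t n0) != 0 by rewrite -hx fmorph_eq0.
  have [z ez] : exists z : int, valq vK (ev iota h0 (t n0)) = z%:~R.
    apply: contrapT => nz; apply: H; exists n0, h0; split=> // z.
    by apply/eqP => ez; apply: nz; exists z.
  have piz0 : pi ^ z != 0 by rewrite expfz_neq0 // (ls_pi0 L).
  exists (pi ^ z) => //; rewrite /subext_val /= hx.
  rewrite (v_fin (ls_val L) h00) (v_fin (ls_val L)) ?fmorph_eq0 // ez.
  by rewrite (valq_exprz z (ls_val L) (ls_pi0 L) (ls_pi L)).
apply: (different_unbounded L f_monic _ f_int f_deriv t0_int t_0 t_S h00 ram).
by rewrite f_deg ltnS ltnW.
Qed.
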